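(* Let $n\ge 2$ and $t\ge 3$. Under the action of the collineation group of $\Lambda=PG(2n-1,q^t)$, the maximum scattered $\mathbb{F}_q$-linear sets of $\Lambda$ of pseudoregulus type fall into exactly $\varphi(t)/2$ orbits, where $\varphi$ denotes Euler's totient function.
   Context: For an $\mathbb{F}_q$-subspace $U$ of the $2n$-dimensional $\mathbb{F}_{q^t}$-space $V$ with $\Lambda=PG(V,\mathbb{F}_{q^t})$, $L_U=\{\langle\mathbf u\rangle_{q^t}:\mathbf u\in U\setminus\{\mathbf 0\}\}$ is the $\mathbb{F}_q$-linear set defined by $U$, of rank $\dim_{\mathbb F_q}U$; the weight of a subspace $PG(W,\mathbb{F}_{q^t})$ in $L_U$ is $\dim_{\mathbb F_q}(W\cap U)$; $L_U$ is scattered if every point has weight 1, and maximum scattered in $PG(2n-1,q^t)$ if it is scattered of rank $tn$. Pseudoregulus type: a scattered $\mathbb{F}_q$-linear set $L$ of $\Lambda$ of rank $tn$ such that (i) there exist $(q^{nt}-1)/(q^t-1)$ pairwise disjoint lines $s_i$ each of weight $t$ in $L$, and (ii) there exist exactly two $(n-1)$-dimensional subspaces $T_1,T_2$ disjoint from $L$ with $T_j\cap s_i\ne\emptyset$ for all $i,j$. *)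

(* Defs.v *)
From HB Require Import structures.
From mathcomp Require Import all_boot all_order all_algebra all_fingroup all_field.
Unset Printing Implicit Defensive.
Import GRing.Theory.
Local Open Scope ring_scope.

(* Conventions:
   - L : finFieldType plays the role of F_{q^t}; K : {set L} is a subfield
     of L with #|K| = q (i.e. F_q), and #|L| = q^t.
   - V = 'rV[L]_(2*n).  A point of PG(V, F_{q^t}) is represented by the set of
     its nonzero vectors; a set of points by the union of these (an
     L^*-closed set of nonzero vectors).
   - An F_q-subspace U is a subset of V containing 0 closed under + and under
     scaling by K; its F_q-dimension is k iff #|U| = q^k. *)

Definition is_subfield {L : finFieldType} (K : {set L}) : bool :=
  [&& 0 \in K, 1 \in K,
      [forall x in K, forall y in K, (x - y \in K) && (x * y \in K)] &
      [forall x in K, x^-1 \in K]].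

Definition Fq_subspace {L : finFieldType} (K : {set L}) (n : nat)
    (U : {set 'rV[L]_(2 * n)}) : bool :=
  [&& 0 \in U, [forall u in U, forall v in U, u + v \in U] &
      [forall a in K, forall u in U, a *: u \in U]].

(* W is an L-subspace of V of (vector) dimension d, i.e. a projective
   subspace of PG(2n-1, q^t) of projective dimension d-1 *)
Definition Lsubspace {L : finFieldType} (n d : nat)
    (W : {set 'rV[L]_(2 * n)}) : bool :=
  [exists M : 'M[L]_(2 * n), (\rank M == d) && (W == [set v | (v <= M)%MS])].

Definition Lspan {L : finFieldType} (n : nat) (u : 'rV[L]_(2 * n))
    : {set 'rV[L]_(2 * n)} := [set a *: u | a : L].

(* the linear set L_U, as the set of nonzero vectors of its points *)
Definition linset {L : finFieldType} (n : nat) (U : {set 'rV[L]_(2 * n)})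
    : {set 'rV[L]_(2 * n)} :=
  [set v | [exists u in U, (u != 0) && [exists a : L, (a != 0) && (v == a *: u)]]].

(* every point of L_U has weight 1: dim_Fq(<u>_{q^t} \cap U) = 1 *)
Definition scattered {L : finFieldType} (q n : nat) (U : {set 'rV[L]_(2 * n)})
    : bool :=
  [forall u in U, (u != 0) ==> (#|Lspan n u :&: U| == (q ^ 1)%N)].

Definition pseudoregulus {L : finFieldType} (K : {set L}) (q t n : nat)
    (A : {set 'rV[L]_(2 * n)}) : bool :=
  [exists U : {set 'rV[L]_(2 * n)},
    [&& Fq_subspace K n U, A == linset n U, #|U| == (q ^ (t * n))%N, scattered q n U &
    [exists S : {set {set 'rV[L]_(2 * n)}},
      [&& #|S| == ((q ^ (n * t) - 1) %/ (q ^ t - 1))%N,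
          [forall s in S, Lsubspace n 2%N s && (#|s :&: U| == (q ^ t)%N)],
          [forall s1 in S, forall s2 in S, (s1 != s2) ==> (s1 :&: s2 == [set 0])] &
          #|[set T : {set 'rV[L]_(2 * n)} | [&& Lsubspace n n T, T :&: A == set0 &
              [forall s in S, exists v, [&& v != 0, v \in s & v \in T]]]]| == 2%N]]]].

Definition is_fieldaut {L : finFieldType} (s : {ffun L -> L}) : bool :=
  [&& injectiveb s, [forall x, forall y, s (x + y) == s x + s y],
      [forall x, forall y, s (x * y) == s x * s y] & s 1 == 1].

(* B is the image of A under a collineation of PG(2n-1,q^t), i.e. an element
   of PGammaL(2n,q^t): v |-> v^sigma M with sigma in Aut(L), M invertible *)
Definition coll_equiv {L : finFieldType} (n : nat) (A B : {set 'rV[L]_(2 * n)})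
    : bool :=
  [exists s : {ffun L -> L}, [exists M : 'M[L]_(2 * n),
    [&& is_fieldaut s, M \in unitmx & B == [set map_mx s v *m M | v in A]]]].

Definition pr_orbits {L : finFieldType} (K : {set L}) (q t n : nat)
    : {set {set {set 'rV[L]_(2 * n)}}} :=
  let PR := [set A : {set 'rV[L]_(2 * n)} | pseudoregulus K q t n A] in
  [set [set B in PR | coll_equiv n A B] | A in PR].

(* Main.v *)
Require Import Defs.
From HB Require Import structures.
From mathcomp Require Import all_boot all_order all_algebra all_fingroup all_field.
From mathcomp Require Import cyclic mxabelem zify ring.

(* A pseudoregulus-type set with transversals T1, T2 is, in the coordinates
   V -> V/T1 x V/T2, the graph of an additive bijection of L^n preserving points,
   hence semilinear; its companion automorphism is x |-> x^(q^i) because it fixes K,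
   and scatteredness means that i is prime to t.  Conversely, for i prime to t, the
   graph {(x, x^(q^i))} is of pseudoregulus type, with the two coordinate spaces as
   its only transversals.  For t >= 3 the lines of the pseudoregulus are recognised
   by the number of their points in the linear set, so a collineation between two
   such sets preserves or exchanges the coordinate spaces; comparing companion
   automorphisms it exists exactly when j = i or j = t - i, the latter by exchanging
   the two coordinates.  The phi(t) exponents are thus paired off. *)

Set Implicit Arguments.
Unset Strict Implicit.
Import GRing.Theory.
Local Open Scope ring_scope.

(** * Subfields of a finite field *)

(** In the definition [U], the lines [S] and the two transversals are bound existentially, so a
    collineation is only known to carry one point set to another. Whatever is to be preserved must
    be recovered from the points alone; hence the counting. In a canonical set a line of the
    pseudoregulus has (q^t-1)/(q-1) points, while any other line with two points has at most q+1.
    The bijection whose graph is [U] preserves points because projecting a line of [S] from a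
    transversal collapses it to a point, and because the lines of [S] exhaust [U] by a count. The
    two transversals are given as merely distinct: that they are complementary is a consequence of i
    > 0, and i > 0 itself has to be extracted from their being distinct. The dimension n >= 2 enters
    twice: an additive bijection of L is too weakly constrained by its action on the single point of
    PG(0, q^t), and two automorphisms of L can be told apart up to proportionality only on vectors
    with at least two coordinates. *)

Lemma expn_sub1_gt0 q t : (1 < q)%N -> (0 < t)%N -> (0 < q ^ t - 1)%N.
Proof. by move=> q1 t0; rewrite subn_gt0 -[1%N](expn0 q) ltn_exp2l. Qed.

Section Subfield.
Variables (L : finFieldType) (K : {set L}) (q : nat).
Hypothesis subK : is_subfield K.
Hypothesis cardK : #|K| = q.
Lemma subfield0 : 0 \in K. Proof. by case/and4P: subK. Qed.
Lemma subfield1 : 1 \in K. Proof. by case/and4P: subK. Qed.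
Lemma subfieldB x y : x \in K -> y \in K -> x - y \in K.
Proof.
by move=> Kx Ky; case/and4P: subK => _ _ /forall_inP/(_ _ Kx)/forall_inP/(_ _ Ky)/andP[].
Qed.
Lemma subfieldM x y : x \in K -> y \in K -> x * y \in K.
Proof.
by move=> Kx Ky; case/and4P: subK => _ _ /forall_inP/(_ _ Kx)/forall_inP/(_ _ Ky)/andP[].
Qed.
Lemma subfieldV x : x \in K -> x^-1 \in K.
Proof. by case/and4P: subK => _ _ _ /forall_inP; apply. Qed.
Lemma subfield_card_gt1 : (1 < q)%N.
Proof.
rewrite -cardK (cardD1 0) (cardD1 1) subfield0 !inE subfield1 oner_neq0 /=; lia.
Qed.

(** Fermat's argument: multiplication by a nonzero [x] permutes the nonzero elements of [K], so
    their product [P] satisfies P = x^(q-1) P. *)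
Lemma subfield_exp x : x \in K -> x ^+ q = x.
Proof.
move=> Kx; case: (eqVneq x 0) => [->|x0].
  by rewrite expr0n; case: (q) subfield_card_gt1.
pose P := \prod_(y in K | y != 0) y.
have P0 : P != 0 by apply/prodf_neq0 => i /andP[].
have xK : {on [pred y | (y \in K) && (y != 0)], bijective (fun y => x * y)}.
  by exists (fun y => x^-1 * y) => y _; rewrite /= ?mulKf ?mulVKf.
have : P = x ^+ q.-1 * P.
  rewrite {1}/P (reindex _ xK) /=.
  have E y : (x * y \in K) && (x * y != 0) = (y \in K) && (y != 0).
    rewrite mulf_eq0 (negPf x0) /=; congr (_ && _); apply/idP/idP => [Kxy|].
      by rewrite -(mulKf x0 y) subfieldM ?subfieldV.
    exact: subfieldM.
  rewrite (eq_bigl _ _ E) big_split /= prodr_const; congr (x ^+ _ * _).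
  rewrite -cardK (cardD1 0 (mem K)) subfield0 /=.
  by apply: eq_card => y; rewrite !inE andbC.
move/eqP; rewrite -subr_eq0 -{1}[P]mul1r -mulrBl mulf_eq0 (negPf P0) orbF subr_eq0.
move/eqP => E.
by rewrite -(prednK (ltnW subfield_card_gt1)) exprS -E mulr1.
Qed.

(** X^q - X has at most q roots and the q elements of [K] are already roots. Membership in [K] thus
    becomes invariance under Frobenius. *)
Lemma subfieldP x : reflect (x ^+ q = x) (x \in K).
Proof.
apply: (iffP idP) => [|xq]; first exact: subfield_exp.
pose p : {poly L} := 'X^q - 'X.
have sp : size p = q.+1.
  by rewrite size_polyDl ?size_polyXn // size_polyN size_polyX ltnS subfield_card_gt1.
have p0 : p != 0 by rewrite -size_poly_eq0 sp.
apply: contraT => Kx.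
have /(max_poly_roots p0) : all (root p) (x :: enum K).
  apply/allP => y; rewrite inE mem_enum rootE /p hornerD hornerN hornerXn hornerX subr_eq0.
  by case/orP => [/eqP->|/subfield_exp->]; rewrite ?xq.
rewrite /= mem_enum Kx enum_uniq sp -cardE cardK => /(_ isT); lia.
Qed.

Variable t : nat.
Hypothesis cardL : #|L| = (q ^ t)%N.
Hypothesis t_gt1 : (1 < t)%N.

Lemma subfield_pnat : [pchar L].-nat q.
Proof.
have [p pp pc] := finPcharP L.
rewrite (eq_pnat _ (pcharf_eq pc)).
have : p.-nat #|[set: pPrimeCharType pc]| := pprimeChar_pgroup pc.
rewrite cardsT cardL pnatX.
by case/orP=> // /eqP t0; move: t_gt1; rewrite t0.
Qed.

Lemma frobenius_exists : exists phi : {rmorphism L -> L}, forall x, phi x = x ^+ q.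
Proof.
have q0 : (0 < q)%N by exact: ltnW subfield_card_gt1.
have fD : nmod_morphism (fun x : L => x ^+ q).
  split; first by rewrite expr0n; case: (q) q0.
  by move=> x y; rewrite exprDn_pchar ?subfield_pnat.
have fM : monoid_morphism (fun x : L => x ^+ q).
  by split; [rewrite expr1n | move=> x y; rewrite exprMn].
pose f : {rmorphism L -> L} := HB.pack (fun x : L => x ^+ q)
  (GRing.isNmodMorphism.Build _ _ _ fD) (GRing.isMonoidMorphism.Build _ _ _ fM).
by exists f.
Qed.

Lemma prim_root_exists : exists g : L, (q ^ t - 1)%N.-primitive_root g.
Proof.
have Q0 := expn_sub1_gt0 subfield_card_gt1 (ltnW t_gt1).
have : has (q ^ t - 1).-primitive_root (enum [set x : L | x != 0]).
  apply: has_prim_root => //.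
  - apply/allP => x; rewrite mem_enum inE => x0; rewrite unity_rootE.
    apply/eqP; apply: (mulfI x0); rewrite -exprS mulr1 -[RHS]expf_card cardL.
    by congr (_ ^+ _); lia.
  - exact: enum_uniq.
  - rewrite -cardE cardsE -cardL subn1 -(cardC1 (0 : L)).
    by rewrite leq_eqVlt; apply/orP; left; apply/eqP/eq_card => x; rewrite !inE.
by case/hasP => g _ gp; exists g.
Qed.
End Subfield.

(** * Powers of the Frobenius automorphism *)

Section RMorphismIter.
Variables (R : nzRingType) (phi : {rmorphism R -> R}).
Definition rmorph_iter i (x : R) := iter i phi x.

Fact rmorph_iter_zmod i : zmod_morphism (rmorph_iter i).
Proof.
by move=> x y; elim: i => //= i IH; rewrite /rmorph_iter /= -/(rmorph_iter _ _) IH rmorphB.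
Qed.
Fact rmorph_iter_monoid i : monoid_morphism (rmorph_iter i).
Proof.
split; first by elim: i => //= i IH; rewrite /rmorph_iter /= -/(rmorph_iter _ _) IH rmorph1.
by move=> x y; elim: i => //= i IH; rewrite /rmorph_iter /= -!/(rmorph_iter _ _) IH rmorphM.
Qed.
HB.instance Definition _ i :=
  GRing.isZmodMorphism.Build R R (rmorph_iter i) (rmorph_iter_zmod i).
HB.instance Definition _ i :=
  GRing.isMonoidMorphism.Build R R (rmorph_iter i) (rmorph_iter_monoid i).
End RMorphismIter.

Section Frobenius.
Variables (L : finFieldType) (K : {set L}) (q t : nat).
Hypothesis subK : is_subfield K.
Hypothesis cardK : #|K| = q.
Hypothesis cardL : #|L| = (q ^ t)%N.
Hypothesis t_gt1 : (1 < t)%N.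
Variable phi : {rmorphism L -> L}.
Hypothesis phiE : forall x, phi x = x ^+ q.

Local Notation frob i := (rmorph_iter phi i).

Lemma frobE i x : frob i x = x ^+ (q ^ i).
Proof.
by elim: i => [|i IH]; rewrite ?expr1 // /rmorph_iter /= -/(frob i x) IH phiE -exprM expnSr.
Qed.

Lemma frobD i j x : frob i (frob j x) = frob (i + j) x.
Proof. by rewrite /rmorph_iter iterD. Qed.

Lemma frob_t x : frob t x = x.
Proof. by rewrite frobE -cardL expf_card. Qed.

Lemma frobK i : (i <= t)%N -> cancel (frob i) (frob (t - i)).
Proof. by move=> it x; rewrite frobD subnK // frob_t. Qed.

Lemma frobVK i : (i <= t)%N -> cancel (frob (t - i)) (frob i).
Proof. by move=> it x; rewrite frobD subnKC // frob_t. Qed.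

Lemma frob_subfield i x : x \in K -> frob i x = x.
Proof.
move=> /(subfieldP subK cardK) xK; elim: i => // i IH.
by rewrite -addn1 -frobD -[frob 1 x]/(phi x) phiE xK.
Qed.

Lemma frob_fix_mul i k x : frob i x = x -> frob (k * i) x = x.
Proof. by move=> xi; elim: k => [|k IH] //; rewrite mulSn -frobD IH. Qed.

(** By Bezout some multiple of [i] is 1 modulo [t], and [frob t] is the identity; so whatever
    [frob i] fixes is fixed by [phi]. *)
Lemma frob_fix_coprime i x : coprime i t -> frob i x = x -> x \in K.
Proof.
move=> cit xi; apply/(subfieldP subK cardK); rewrite -phiE.
have [i0|i0] := posnP i.
  by move: cit t_gt1; rewrite i0 /coprime gcd0n => /eqP ->.
case: (egcdnP t i0) => km kn E _; rewrite (eqP cit) in E.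
have := frob_fix_mul km xi; rewrite E addnC -frobD.
by rewrite frob_fix_mul ?frob_t.
Qed.

Lemma frob_fix_not_coprime i :
  (i < t)%N -> ~~ coprime i t -> exists2 x, x \notin K & frob i x = x.
Proof.
move=> it; rewrite /coprime; set d := gcdn i t => d1.
have q1 := subfield_card_gt1 subK cardK.
have d0 : (0 < d)%N by rewrite gcdn_gt0; apply/orP; right; lia.
have d2 : (1 < d)%N by lia.
have [g gp] := prim_root_exists subK cardK cardL t_gt1.
have dvd : (q ^ d - 1 %| q ^ t - 1)%N.
  rewrite -(divnK (dvdn_gcdr i t)) -/d mulnC expnM.
  by rewrite -[X in (_ %| _ - X)%N](exp1n (t %/ d)) subn_exp dvdn_mulr.
(* As g generates the nonzero elements of L, g^m generates those of the subfield of order q^d. Since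
   d > 1, this generator is outside [K]; it is fixed by [frob d], hence by [frob i]. *)
pose m := ((q ^ t - 1) %/ (q ^ d - 1))%N.
have mE : (m * (q ^ d - 1))%N = (q ^ t - 1)%N by rewrite divnK.
have m0 : (0 < m)%N.
  by have := expn_sub1_gt0 q1 (ltnW t_gt1); rewrite -mE muln_gt0 => /andP[].
have dq := expn_sub1_gt0 q1 d0.
exists (g ^+ m).
  apply/negP => /(subfieldP subK cardK)/eqP; rewrite -exprM (eq_prim_root_expr gp).
  rewrite eqn_mod_dvd ?leq_pmulr ?(ltnW q1) // -{2}[m]muln1 -mulnBr -mE.
  rewrite dvdn_pmul2l // => /dvdn_leq; rewrite subn_gt0 q1 => /(_ isT).
  have : (q ^ 1 < q ^ d)%N by rewrite ltn_exp2l.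
  rewrite expn1; lia.
have [k kE] := dvdnP (dvdn_gcdl i t); rewrite kE; apply: frob_fix_mul.
rewrite frobE -exprM -/d -[in LHS](subnK (_ : 1 <= q ^ d)%N); last by rewrite expn_gt0; lia.
by rewrite mulnDr mE muln1 exprD (prim_expr_order gp) mul1r.
Qed.

(** Evaluate at a primitive root of order q^t - 1: the exponents q^i and q^j are below that order,
    so equal powers have equal exponents. *)
Lemma frob_inj i j : (i < t)%N -> (j < t)%N -> frob i =1 frob j -> i = j.
Proof.
move=> it jt E; have q1 := subfield_card_gt1 subK cardK.
have [g gp] := prim_root_exists subK cardK cardL t_gt1.
have small k : (k < t)%N -> (q ^ k < q ^ t - 1)%N.
  move=> kt; have : (q ^ k <= q ^ t.-1)%N by rewrite leq_exp2l //; lia.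
  have : (q ^ 1 <= q ^ t.-1)%N by rewrite leq_exp2l //; lia.
  have -> : (q ^ t = q * q ^ t.-1)%N by rewrite -expnS; congr (_ ^ _)%N; lia.
  by rewrite expn1; nia.
have /eqP := E g; rewrite !frobE (eq_prim_root_expr gp) !modn_small ?small //.
by rewrite eqn_exp2l // => /eqP.
Qed.

(* The coefficients of [\prod_j ('X - g^(q^j))] are fixed by [phi], hence lie in
   K, so [s] permutes its roots. *)
Lemma rmorph_frob (s : {rmorphism L -> L}) :
  {in K, forall x, s x = x} -> exists2 i, (i < t)%N & s =1 frob i.
Proof.
move=> sK; have [g gp] := prim_root_exists subK cardK cardL t_gt1.
pose P : {poly L} := \prod_(j < t) ('X - (frob j g)%:P).
have t0 : (0 < t)%N by lia.
have phiP : map_poly phi P = P.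
  rewrite /P map_prod_XsubC -(prednK t0) big_ord_recr [RHS]big_ord_recl /= mulrC.
  congr (_ * _).
  by rewrite -[in RHS](frob_t g) -[in RHS](prednK t0).
have sP : map_poly s P = P.
  apply/polyP => k; rewrite coef_map /= sK //; apply/(subfieldP subK cardK).
  by rewrite -phiE -[in RHS]phiP coef_map.
have : root P (s g).
  rewrite -sP rootE horner_map /= /P -(prednK t0) big_ord_recl /=.
  by rewrite hornerM hornerXsubC subrr mul0r rmorph0.
rewrite /root /P horner_prod => /eqP/eqP/prodf_eq0[j _].
rewrite hornerXsubC subr_eq0 => /eqP sg.
exists j => // x; case: (eqVneq x 0) => [->|x0]; first by rewrite !rmorph0.
have xu : x ^+ (q ^ t - 1) = 1.
  apply: (mulfI x0); rewrite -exprS mulr1 -[RHS]expf_card cardL; congr (_ ^+ _).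
  by have := expn_sub1_gt0 (subfield_card_gt1 subK cardK) t0; lia.
by have [k ->] := prim_rootP gp xu; rewrite !rmorphXn sg.
Qed.
End Frobenius.

(** * Coordinates and subspaces *)

Lemma rank_factor (F : fieldType) (m k r : nat) (A : 'M[F]_(m, k)) :
  \rank A = r -> exists P : 'M[F]_(m, r), forall v : 'rV_m, (v *m A == 0) = (v *m P == 0).
Proof.
move=> <-; exists (col_base A) => v.
by rewrite -{1}(mulmx_base A) mulmxA mulmx_free_eq0 // row_base_free.
Qed.

Section Coordinates.
Variables (L : fieldType) (n : nat).

Fact addnn2 : (n + n = 2 * n)%N. Proof. by lia. Qed.

Definition inj1 : 'M[L]_(n, 2 * n) := castmx (erefl, addnn2) (row_mx 1%:M 0).
Definition inj2 : 'M[L]_(n, 2 * n) := castmx (erefl, addnn2) (row_mx 0 1%:M).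
Definition proj1 : 'M[L]_(2 * n, n) := inj1^T.
Definition proj2 : 'M[L]_(2 * n, n) := inj2^T.

Lemma inj1K : inj1 *m proj1 = 1%:M.
Proof.
rewrite /proj1 /inj1; case: _ / addnn2; rewrite castmx_id tr_row_mx mul_row_col.
by rewrite trmx1 mulmx1 mul0mx addr0.
Qed.
Lemma inj2K : inj2 *m proj2 = 1%:M.
Proof.
rewrite /proj2 /inj2; case: _ / addnn2; rewrite castmx_id tr_row_mx mul_row_col.
by rewrite trmx1 mulmx1 mul0mx add0r.
Qed.
Lemma inj1_proj2 : inj1 *m proj2 = 0.
Proof.
rewrite /proj2 /inj1 /inj2; case: _ / addnn2; rewrite !castmx_id tr_row_mx mul_row_col.
by rewrite trmx1 trmx0 mulmx0 mul0mx addr0.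
Qed.
Lemma inj2_proj1 : inj2 *m proj1 = 0.
Proof.
rewrite /proj1 /inj1 /inj2; case: _ / addnn2; rewrite !castmx_id tr_row_mx mul_row_col.
by rewrite trmx1 trmx0 mulmx0 mul0mx addr0.
Qed.
Lemma proj_inj : proj1 *m inj1 + proj2 *m inj2 = 1%:M.
Proof.
rewrite /proj1 /proj2 /inj1 /inj2; case: _ / addnn2; rewrite !castmx_id !tr_row_mx.
rewrite !mul_col_row !trmx1 !trmx0 !mulmx0 !mul0mx !mulmx1 add_block_mx.
by rewrite !addr0 !add0r -scalar_mx_block.
Qed.

Definition emb (x y : 'rV[L]_n) : 'rV[L]_(2 * n) := x *m inj1 + y *m inj2.

Lemma emb_proj1 x y : emb x y *m proj1 = x.
Proof. by rewrite mulmxDl -!mulmxA inj1K inj2_proj1 mulmx1 mulmx0 addr0. Qed.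
Lemma emb_proj2 x y : emb x y *m proj2 = y.
Proof. by rewrite mulmxDl -!mulmxA inj2K inj1_proj2 mulmx1 mulmx0 add0r. Qed.
Lemma emb_proj v : emb (v *m proj1) (v *m proj2) = v.
Proof. by rewrite /emb -!mulmxA -mulmxDr proj_inj mulmx1. Qed.
Lemma emb_inj x y x' y' : emb x y = emb x' y' -> x = x' /\ y = y'.
Proof.
by move=> E; rewrite -(emb_proj1 x y) E emb_proj1 -{1}(emb_proj2 x y) E emb_proj2.
Qed.
Lemma embD x y x' y' : emb x y + emb x' y' = emb (x + x') (y + y').
Proof. by rewrite /emb !mulmxDl addrACA. Qed.
Lemma embZ a x y : a *: emb x y = emb (a *: x) (a *: y).
Proof. by rewrite /emb scalerDr !scalemxAl. Qed.
Lemma emb0 : emb 0 0 = 0. Proof. by rewrite /emb !mul0mx addr0. Qed.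
Lemma embB x y x' y' : emb x y - emb x' y' = emb (x - x') (y - y').
Proof. by rewrite -scaleN1r embZ embD !scaleN1r. Qed.
Lemma emb_eq0 x y : (emb x y == 0) = (x == 0) && (y == 0).
Proof.
apply/eqP/andP => [|[/eqP-> /eqP->]]; last exact: emb0.
by rewrite -emb0 => /emb_inj[-> ->].
Qed.

Lemma map_emb (s : {rmorphism L -> L}) x y :
  map_mx s (emb x y) = emb (map_mx s x) (map_mx s y).
Proof.
rewrite /emb map_mxD !map_mxM /inj1 /inj2 !map_castmx !map_row_mx !map_mx0.
by rewrite !map_mx1.
Qed.
End Coordinates.

Section Subspaces.
Variables (L : finFieldType) (n : nat).
Implicit Types (U W s T : {set 'rV[L]_(2 * n)}) (u v w : 'rV[L]_(2 * n)).

Lemma linsetP U v :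
  reflect (exists2 u, u \in U & u != 0 /\ exists2 a : L, a != 0 & v = a *: u)
          (v \in linset n U).
Proof.
rewrite inE; apply: (iffP exists_inP) => [[u Uu /andP[u0 /existsP[a /andP[a0 /eqP vE]]]]|].
  by exists u => //; split=> //; exists a.
case=> u Uu [u0 [a a0 vE]]; exists u => //; rewrite u0; apply/existsP.
by exists a; rewrite a0 vE eqxx.
Qed.

Lemma mem_linset U u : u \in U -> u != 0 -> u \in linset n U.
Proof.
move=> Uu u0; apply/linsetP; exists u => //; split=> //.
by exists 1; rewrite ?oner_neq0 ?scale1r.
Qed.

(** Trades the matrix for closure and a count, the form in which images and spans are easiest to
    recognise as subspaces. Conversely, the sum of the row spaces of the elements of [W] is [W], and
    the cardinality determines its rank. *)
Lemma LsubspaceP d W :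
  reflect [/\ 0 \in W, (forall a u v, u \in W -> v \in W -> a *: u + v \in W)
            & #|W| = (#|L| ^ d)%N]
          (Lsubspace n d W).
Proof.
apply: (iffP existsP) => [[M /andP[/eqP rM /eqP ->]]|[W0 Wlin cW]].
  split; first by rewrite inE sub0mx.
    by move=> a u v; rewrite !inE => uM vM; apply: addmx_sub => //; apply: scalemx_sub.
  by rewrite -rM -card_rowg; apply: eq_card => v; rewrite !inE.
pose M := (\sum_(w in W) <<w>>)%MS; exists M.
have WM : W = [set v | (v <= M)%MS].
  apply/setP => v; rewrite inE; apply/idP/idP => [Wv|].
    by apply: (sumsmx_sup v); rewrite ?genmxE.
  case/sub_sumsmxP => c ->; apply: (big_ind (fun v => v \in W)) => //.
    by move=> x y Wx Wy; rewrite -[x]scale1r Wlin.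
  move=> w Ww; have /sub_rVP[a ->] : (c w *m <<w>> <= w)%MS.
    by rewrite -(genmxE w) submxMl.
  by rewrite -[_ *: _]addr0 Wlin.
rewrite -WM eqxx andbT.
have : (#|L| ^ \rank M = #|L| ^ d)%N.
  by rewrite -cW WM -card_rowg; apply: eq_card => v; rewrite !inE.
by move/eqP; rewrite eqn_exp2l // finNzRing_gt1.
Qed.

Lemma Lsubspace0 d W : Lsubspace n d W -> 0 \in W.
Proof. by case/LsubspaceP. Qed.
Lemma LsubspaceZ d W a u : Lsubspace n d W -> u \in W -> a *: u \in W.
Proof. by case/LsubspaceP=> W0 Wl _ Wu; rewrite -[_ *: _]addr0 Wl. Qed.
Lemma LsubspaceD d W u v : Lsubspace n d W -> u \in W -> v \in W -> u + v \in W.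
Proof. by case/LsubspaceP=> W0 Wl _ Wu Wv; rewrite -[u]scale1r Wl. Qed.
Lemma LsubspaceB d W u v : Lsubspace n d W -> u \in W -> v \in W -> u - v \in W.
Proof. by case/LsubspaceP=> W0 Wl _ Wu Wv; rewrite -scaleN1r addrC Wl. Qed.
Lemma card_Lsubspace d W : Lsubspace n d W -> #|W| = (#|L| ^ d)%N.
Proof. by case/LsubspaceP. Qed.

Lemma Lsubspace_imset d W (M : 'M[L]_(2 * n)) :
  M \in unitmx -> Lsubspace n d W -> Lsubspace n d [set v *m M | v in W].
Proof.
move=> uM /LsubspaceP[W0 Wl cW]; apply/LsubspaceP; split.
- by apply/imsetP; exists 0; rewrite ?mul0mx.
- move=> a _ _ /imsetP[u Wu ->] /imsetP[v Wv ->].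
  by apply/imsetP; exists (a *: u + v); rewrite ?Wl // mulmxDl scalemxAl.
- by rewrite card_imset //; apply: can_inj (mulmxK uM).
Qed.

Definition lincomb2 v w : {set 'rV[L]_(2 * n)} :=
  [set p.1 *: v + p.2 *: w | p : L * L].

Lemma lincomb2P v w x : reflect (exists a b, x = a *: v + b *: w) (x \in lincomb2 v w).
Proof.
apply: (iffP imsetP) => [[[a b] _ ->]|[a [b ->]]]; first by exists a, b.
by exists (a, b).
Qed.

Lemma indep2 v w (a b : L) :
  v != 0 -> (forall c, w <> c *: v) -> a *: v + b *: w = 0 -> a = 0 /\ b = 0.
Proof.
move=> v0 vw E; case: (eqVneq b 0) E => [->|b0 E].
  rewrite scale0r addr0 => /eqP; rewrite scaler_eq0 (negPf v0) orbF => /eqP.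
  by [].
case: (vw (- b^-1 * a)); rewrite -scalerA -[a *: v](addrK (b *: w)) E sub0r.
by rewrite scalerN scaleNr opprK scalerK.
Qed.

Lemma lincomb2_line v w :
  v != 0 -> (forall c, w <> c *: v) -> Lsubspace n 2 (lincomb2 v w).
Proof.
move=> v0 vw; apply/LsubspaceP; split.
- by apply/lincomb2P; exists 0, 0; rewrite !scale0r addr0.
- move=> a _ _ /lincomb2P[b [c ->]] /lincomb2P[b' [c' ->]]; apply/lincomb2P.
  exists (a * b + b'), (a * c + c').
  by rewrite scalerDr !scalerA !scalerDl addrACA.
rewrite /lincomb2 card_imset; first by rewrite card_prod -mulnn.
move=> [a b] [c d] /= /eqP; rewrite -subr_eq0 opprD addrACA -!scalerBl => /eqP.
by case/(indep2 v0 vw) => /subr0_eq-> /subr0_eq->.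
Qed.

Lemma line_lincomb2 s v w :
  Lsubspace n 2 s -> v \in s -> w \in s -> v != 0 -> (forall c, w <> c *: v) ->
  s = lincomb2 v w.
Proof.
move=> sL sv sw v0 vw; apply/esym/eqP; rewrite eqEcard.
rewrite (card_Lsubspace (lincomb2_line v0 vw)) (card_Lsubspace sL) leqnn andbT.
apply/subsetP => x /lincomb2P[a [b ->]].
by apply: (LsubspaceD sL); apply: (LsubspaceZ _ sL).
Qed.

(** [P] is the projection V -> V/T written in n coordinates: the cokernel matrix has rank n, and its
    column base has n columns and the same kernel. *)
Lemma Lsubspace_quotient T :
  Lsubspace n n T ->
  exists P : 'M[L]_(2 * n, n), forall v, (v \in T) = (v *m P == 0).
Proof.
case/existsP=> M /andP[/eqP rM /eqP ->].
have rC : \rank (cokermx M) = n by rewrite mxrank_coker rM; lia.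
have [P PE] := rank_factor rC; exists P => v.
by rewrite inE submxE PE.
Qed.
End Subspaces.

(** * The linear set of the graph of a power of Frobenius *)

(** Used with Q = q^t. After multiplication by q - 1, the left side bounds the vectors of the linear
    set on a subline from above, the right side those on a pseudoregulus line from below. The
    inequality fails at Q = q^2, so this is where t >= 3 matters. *)
Lemma sublineI_card_lt q Q :
  (1 < q)%N -> (q ^ 3 <= Q)%N -> (q.+1 * Q * (q - 1) < (Q - 1) ^ 2)%N.
Proof.
case: q => [|[|r]] // _; rewrite !expnS !expn0 !muln1 subn1 /= => le_qQ.
have [k ->] : exists k, Q = (r.+2 * (r.+2 * r.+2) + k)%N.
  by exists (Q - r.+2 * (r.+2 * r.+2))%N; lia.
have -> : (r.+2 * (r.+2 * r.+2) + k - 1 = r * r * r + 6 * (r * r) + 12 * r + 7 + k)%N by lia.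
nia.
Qed.

Lemma scaler_inj_r (F : fieldType) (W : lmodType F) (x : W) :
  x != 0 -> injective (fun a : F => a *: x).
Proof.
move=> x0 a b /eqP; rewrite -subr_eq0 -scalerBl scaler_eq0 (negPf x0) orbF subr_eq0.
by move/eqP.
Qed.

Lemma card_imset_fibers (aT rT : finType) (f : aT -> rT) (D : {set aT}) k :
  {in D, forall x, #|[set y in D | f y == f x]| = k} ->
  #|D| = (#|f @: D| * k)%N.
Proof.
move=> fk; rewrite -sum1_card (partition_big_imset f) /= -sum_nat_const.
apply: eq_bigr => _ /imsetP[x Dx ->]; rewrite sum1_card -(fk x Dx).
by apply: eq_card => y; rewrite !inE.
Qed.

Lemma cards_neq0 (V : finZmodType) : #|[set x : V | x != 0]| = #|V|.-1.
Proof. by rewrite -(cardC1 (0 : V)); apply: eq_card => x; rewrite !inE. Qed.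

Lemma unitmx_injP (F : fieldType) n (A : 'M[F]_n) :
  (forall x : 'rV_n, x *m A = 0 -> x = 0) -> A \in unitmx.
Proof. by move=> A0; rewrite -row_free_unit; apply/inj_row_free. Qed.

Lemma map_mx_eq0_rV (F : fieldType) (s : {rmorphism F -> F}) n (x : 'rV_n) :
  (map_mx s x == 0) = (x == 0).
Proof. exact: map_mx_eq0. Qed.

(* Test the proportionality on [a e_1 + e_2]: the first two coordinates force
   [s a = t a]. *)
Lemma semilinear_proportional (F : fieldType) n (s t : {rmorphism F -> F})
    (C : 'M[F]_n) :
  (1 < n)%N -> C \in unitmx ->
  (forall x : 'rV_n, x != 0 -> exists c, map_mx s x *m C = c *: map_mx t x) ->
  s =1 t.
Proof.
case: n C => [|[|n]] // C _ uC sC a.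
pose e1 : 'rV[F]_n.+2 := delta_mx 0 0; pose e2 : 'rV[F]_n.+2 := delta_mx 0 1.
have e11 : e1 0 0 = 1 by rewrite mxE eqxx.
have e12 : e1 0 1 = 0 by rewrite mxE.
have e21 : e2 0 0 = 0 by rewrite mxE.
have e22 : e2 0 1 = 1 by rewrite mxE eqxx.
have m1 (u : {rmorphism F -> F}) : map_mx u e1 = e1 by rewrite map_delta_mx.
have m2 (u : {rmorphism F -> F}) : map_mx u e2 = e2 by rewrite map_delta_mx.
move: e1 e2 e11 e12 e21 e22 m1 m2 => e1 e2 e11 e12 e21 e22 m1 m2.
have e10 : e1 != 0.
  by apply/eqP => /matrixP/(_ 0 0)/eqP; rewrite e11 mxE oner_eq0.
have e20 : e2 != 0.
  by apply/eqP => /matrixP/(_ 0 1)/eqP; rewrite e22 mxE oner_eq0.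
have [c1 E1] := sC e1 e10; have [c2 E2] := sC e2 e20.
rewrite !m1 !m2 in E1 E2.
have E b : s b * c1 = c2 * t b.
  have [|c] := sC (b *: e1 + e2).
    by apply/eqP => /matrixP/(_ 0 1)/eqP; rewrite !mxE e12 mulr0 add0r e22 oner_eq0.
  rewrite !map_mxD !map_mxZ !m1 !m2 mulmxDl -scalemxAl E1 E2 => /matrixP Ec.
  have := Ec 0 0; have := Ec 0 1; rewrite !mxE e11 e12 e21 e22.
  by rewrite !mulr0 !add0r !addr0 !mulr1 => -> ->.
have c12 : c1 = c2 by have := E 1; rewrite !rmorph1 mul1r mulr1.
have c10 : c1 != 0.
  apply: contra_neq e10 => c0; rewrite -[e1](mulmxK uC) E1 c0 scale0r mul0mx //.
by have := E a; rewrite -c12 [RHS]mulrC => /(mulIf c10).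
Qed.

Section Canonical.
Variables (L : finFieldType) (K : {set L}) (q t n : nat).
Hypothesis subK : is_subfield K.
Hypothesis cardK : #|K| = q.
Hypothesis cardL : #|L| = (q ^ t)%N.
Hypothesis t_gt1 : (1 < t)%N.
Variable phi : {rmorphism L -> L}.
Hypothesis phiE : forall x, phi x = x ^+ q.
Hypothesis n_gt1 : (1 < n)%N.

Local Notation frob i := (rmorph_iter phi i).
Local Notation fv i x := (map_mx (rmorph_iter phi i) x).
Local Notation q_gt1 := (subfield_card_gt1 subK cardK).
Local Notation V := 'rV[L]_(2 * n).

Definition graph i (x : 'rV[L]_n) : V := emb x (fv i x).
Definition graph_set i : {set V} := [set graph i x | x : 'rV[L]_n].
Definition graph_linset i := linset n (graph_set i).
(** The pseudoregulus lines, indexed by the points of PG(n-1, q^t): the graph vectors over all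
    multiples of [x] lie on this one line. *)
Definition graph_line i (x : 'rV[L]_n) : {set V} := lincomb2 (emb x 0) (emb 0 (fv i x)).
Definition axis1 : {set V} := [set emb x 0 | x : 'rV[L]_n].
Definition axis2 : {set V} := [set emb 0 x | x : 'rV[L]_n].

Lemma graph_inj i : injective (graph i).
Proof. by move=> x y /emb_inj[]. Qed.

Lemma graphD i x y : graph i x + graph i y = graph i (x + y).
Proof. by rewrite /graph embD map_mxD. Qed.

Lemma graphZ i a x : frob i a = a -> a *: graph i x = graph i (a *: x).
Proof. by move=> ai; rewrite /graph embZ map_mxZ /= ai. Qed.

Lemma graph_eq0 i x : (graph i x == 0) = (x == 0).
Proof. by rewrite /graph emb_eq0 map_mx_eq0_rV andbb. Qed.

Lemma mem_graph_set i x : graph i x \in graph_set i.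
Proof. exact: imset_f. Qed.

Lemma card_rV : #|{: 'rV[L]_n}| = (q ^ (t * n))%N.
Proof. by rewrite card_mx mul1n cardL expnM. Qed.

Lemma card_graph_set i : #|graph_set i| = (q ^ (t * n))%N.
Proof. by rewrite card_imset ?card_rV //; apply: graph_inj. Qed.

Lemma graph_linsetP i v :
  reflect (exists a x, [/\ a != 0, x != 0 & v = a *: graph i x])
          (v \in graph_linset i).
Proof.
apply: (iffP (linsetP _ _)) => [[_ /imsetP[x _ ->] [x0 [a a0 ->]]]|[a [x [a0 x0 ->]]]].
  by exists a, x; split=> //; rewrite graph_eq0 in x0.
by exists (graph i x); rewrite ?mem_graph_set // graph_eq0; split=> //; exists a.
Qed.

Lemma graph_in_linset i x : x != 0 -> graph i x \in graph_linset i.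
Proof. by move=> x0; apply/graph_linsetP; exists 1, x; rewrite oner_neq0 scale1r. Qed.

Lemma graph_lineP i x v :
  reflect (exists a b, v = emb (a *: x) (b *: fv i x)) (v \in graph_line i x).
Proof.
have E a b : a *: emb x 0 + b *: emb 0 (fv i x) = emb (a *: x) (b *: fv i x).
  by rewrite !embZ embD !scaler0 addr0 add0r.
by apply: (iffP (lincomb2P _ _ _)) => -[a [b ->]]; exists a, b; rewrite E.
Qed.

Lemma graph_line_graph i x a : graph i (a *: x) \in graph_line i x.
Proof. by apply/graph_lineP; exists a, (frob i a); rewrite /graph map_mxZ. Qed.

Lemma graph_line_axis1 i x : emb x 0 \in graph_line i x.
Proof. by apply/graph_lineP; exists 1, 0; rewrite scale1r scale0r. Qed.

Lemma graph_line_axis2 i x : emb 0 (fv i x) \in graph_line i x.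
Proof. by apply/graph_lineP; exists 0, 1; rewrite scale1r scale0r. Qed.

Lemma graph_line_Lsubspace i x : x != 0 -> Lsubspace n 2 (graph_line i x).
Proof.
move=> x0; apply: lincomb2_line; first by rewrite emb_eq0 negb_and x0.
move=> c; rewrite embZ => /emb_inj[_ /eqP].
by rewrite scaler0 map_mx_eq0_rV (negPf x0).
Qed.

Lemma graph_lineZ i x c : c != 0 -> graph_line i (c *: x) = graph_line i x.
Proof.
move=> c0; apply/setP => v; apply/graph_lineP/graph_lineP => -[a [b ->]].
  by exists (a * c), (b * frob i c); rewrite map_mxZ !scalerA.
exists (a / c), (b / frob i c); rewrite map_mxZ !scalerA !divfK // fmorph_eq0 //.
Qed.

Lemma scaler_proportional (x y : 'rV[L]_n) a b :
  a != 0 -> x != 0 -> a *: x = b *: y -> exists2 c, c != 0 & y = c *: x.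
Proof.
move=> a0 x0 E; have b0 : b != 0.
  by apply/eqP => b0; move/eqP: E; rewrite b0 scale0r scaler_eq0 (negPf a0) (negPf x0).
exists (b^-1 * a); first by rewrite mulf_neq0 ?invr_eq0.
by rewrite -scalerA E scalerK.
Qed.

Lemma frob_proportional i (x y : 'rV[L]_n) c :
  (i <= t)%N -> fv i y = c *: fv i x -> y = frob (t - i) c *: x.
Proof.
move=> it; move/(congr1 (fun z => fv (t - i) z)); rewrite map_mxZ.
have E z : fv (t - i) (fv i z) = z :> 'rV[L]_n.
  by apply/matrixP => j k; rewrite !mxE (frobK cardL phiE it).
by rewrite !E.
Qed.

Lemma graph_line_meet i x y v :
  (i <= t)%N -> x != 0 -> y != 0 -> v != 0 ->
  v \in graph_line i x -> v \in graph_line i y -> exists2 c, c != 0 & y = c *: x.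
Proof.
move=> it x0 y0 v0 /graph_lineP[a [b vE]] /graph_lineP[c [d]].
rewrite vE => /emb_inj[Ea Eb]; rewrite vE emb_eq0 negb_and in v0.
case: (eqVneq a 0) v0 => [-> /= v0|a0 _]; last exact: scaler_proportional Ea.
have b0 : b != 0.
  apply: contraTneq v0 => ->; rewrite !scale0r eqxx //.
have [|e e0] := scaler_proportional b0 _ Eb; first by rewrite map_mx_eq0_rV.
move/(frob_proportional it) => yE; exists (frob (t - i) e) => //.
by rewrite fmorph_eq0.
Qed.

(** * Scatteredness and the pseudoregulus when [i] is prime to [t] *)

Section Coprime.
Variable i : nat.
Hypothesis it : (i <= t)%N.
Hypothesis cit : coprime i t.

(** The first coordinate forces the base point to be [a *: x], the second then forces a^(q^i) = a;
    coprimality leaves only [K]. *)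
Lemma graph_set_scale x a : x != 0 -> (a *: graph i x \in graph_set i) = (a \in K).
Proof.
move=> x0; apply/imsetP/idP => [[y _]|aK]; last first.
  by exists (a *: x); rewrite // graphZ // (frob_subfield subK cardK).
rewrite /graph embZ => /emb_inj[<- /eqP]; rewrite map_mxZ -subr_eq0 -scalerBl scaler_eq0.
rewrite map_mx_eq0_rV (negPf x0) orbF subr_eq0 => /eqP ai.
by apply: (frob_fix_coprime subK cardK cardL t_gt1 phiE cit).
Qed.

Lemma graph_set_Fq_subspace : Fq_subspace K n (graph_set i).
Proof.
apply/and3P; split.
- by apply/imsetP; exists 0; rewrite // /graph map_mx0 emb0.
- apply/forall_inP => _ /imsetP[x _ ->]; apply/forall_inP => _ /imsetP[y _ ->].
  by rewrite graphD mem_graph_set.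
- apply/forall_inP => a aK; apply/forall_inP => _ /imsetP[x _ ->].
  by rewrite graphZ ?mem_graph_set // (frob_subfield subK cardK).
Qed.

Lemma graph_set_scattered : scattered q n (graph_set i).
Proof.
apply/forall_inP => _ /imsetP[x _ ->]; apply/implyP; rewrite graph_eq0 => x0.
apply/eqP; rewrite expn1 -cardK -(card_imset K (f := fun a => a *: graph i x)).
  apply: eq_card => v; rewrite inE; apply/andP/imsetP => [[/imsetP[a _ ->]]|[a aK ->]].
    by rewrite graph_set_scale // => aK; exists a.
  by split; [exact: imset_f | rewrite graph_set_scale].
by apply: scaler_inj_r; rewrite graph_eq0.
Qed.

Lemma card_graph_lineI x : x != 0 -> #|graph_line i x :&: graph_set i| = (q ^ t)%N.
Proof.
move=> x0; rewrite -cardL -(card_imset L (f := fun a => graph i (a *: x))).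
  apply: eq_card => v; rewrite inE.
  apply/andP/imsetP => [[/graph_lineP[a [b ->]] /imsetP[y _]]|[a _ ->]].
    by case/emb_inj=> <- ->; exists a.
  by rewrite graph_line_graph mem_graph_set.
by move=> a b /graph_inj/(scaler_inj_r x0).
Qed.

Definition graph_lines : {set {set V}} := [set graph_line i x | x in [set x | x != 0]].

(** Two nonzero vectors give the same line exactly when they are proportional, so the fibres of
    [graph_line i] all have q^t - 1 elements. *)
Lemma card_graph_lines : #|graph_lines| = ((q ^ (n * t) - 1) %/ (q ^ t - 1))%N.
Proof.
have Q0 := expn_sub1_gt0 q_gt1 (ltnW t_gt1).
rewrite (mulnC n t) -card_rV subn1 -cards_neq0.
rewrite (@card_imset_fibers _ _ (graph_line i) _ (q ^ t - 1)).
  by rewrite mulnK.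
move=> x; rewrite inE => x0.
rewrite subn1 -cardL -cards_neq0 -(card_imset _ (f := fun a => a *: x)).
  apply: eq_card => y; rewrite !inE; apply/andP/imsetP => [[y0 /eqP E]|[a]].
    have [|||c c0 ->] := @graph_line_meet i x y (emb y 0) it x0 y0.
    - by rewrite emb_eq0 negb_and y0.
    - by rewrite -E graph_line_axis1.
    - exact: graph_line_axis1.
    - by exists c; rewrite ?inE.
  by rewrite inE => a0 ->; rewrite graph_lineZ // scaler_eq0 negb_or a0 x0.
exact: scaler_inj_r.
Qed.
End Coprime.

(** * The coordinate subspaces as the only transversals *)

Lemma axis1P v : reflect (v *m proj2 L n = 0) (v \in axis1).
Proof.
apply: (iffP imsetP) => [[x _ ->]|v0]; first by rewrite emb_proj2.
by exists (v *m proj1 L n); rewrite // -v0 emb_proj.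
Qed.

Lemma axis2P v : reflect (v *m proj1 L n = 0) (v \in axis2).
Proof.
apply: (iffP imsetP) => [[x _ ->]|v0]; first by rewrite emb_proj1.
by exists (v *m proj2 L n); rewrite // -v0 emb_proj.
Qed.

Lemma axis1_Lsubspace : Lsubspace n n axis1.
Proof.
apply/LsubspaceP; split.
- by apply/axis1P; rewrite mul0mx.
- move=> a u v /axis1P Eu /axis1P Ev; apply/axis1P.
  by rewrite mulmxDl -scalemxAl Eu Ev scaler0 addr0.
- by rewrite card_imset ?card_mx ?mul1n // => x y /emb_inj[].
Qed.

Lemma axis2_Lsubspace : Lsubspace n n axis2.
Proof.
apply/LsubspaceP; split.
- by apply/axis2P; rewrite mul0mx.
- move=> a u v /axis2P Eu /axis2P Ev; apply/axis2P.
  by rewrite mulmxDl -scalemxAl Eu Ev scaler0 addr0.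
- by rewrite card_imset ?card_mx ?mul1n // => x y /emb_inj[].
Qed.

Lemma rV_neq0_exists : exists x : 'rV[L]_n, x != 0.
Proof.
have : (1 < #|{: 'rV[L]_n}|)%N.
  rewrite card_rV; apply: leq_trans (q_gt1) _.
  by rewrite -{1}[q]expn1 leq_pexp2l ?(ltnW q_gt1) // muln_gt0; lia.
rewrite (cardD1 0) inE ltnS => /card_gt0P[x]; rewrite !inE andbT => x0.
by exists x.
Qed.

Lemma axis1_neq_axis2 : axis1 != axis2.
Proof.
have [x x0] := rV_neq0_exists.
apply: contra_neq x0 => E.
have : emb x 0 \in axis2 by rewrite -E; apply: imset_f.
by move/axis2P; rewrite emb_proj1.
Qed.

Lemma axis1_linset i : axis1 :&: graph_linset i = set0.
Proof.
apply/setP => v; rewrite in_setI in_set0.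
apply/andP => -[/axis1P v0] /graph_linsetP[a [x [a0 x0 vE]]].
move: v0; rewrite vE embZ emb_proj2 => /eqP.
by rewrite scaler_eq0 (negPf a0) map_mx_eq0_rV (negPf x0).
Qed.

Lemma axis2_linset i : axis2 :&: graph_linset i = set0.
Proof.
apply/setP => v; rewrite in_setI in_set0.
apply/andP => -[/axis2P v0] /graph_linsetP[a [x [a0 x0 vE]]].
move: v0; rewrite vE embZ emb_proj1 => /eqP.
by rewrite scaler_eq0 (negPf a0) (negPf x0).
Qed.

Lemma fvK i : (i <= t)%N -> cancel (fun x : 'rV[L]_n => fv i x) (fun x => fv (t - i) x).
Proof. by move=> le_it x; apply/matrixP => j k; rewrite !mxE (frobK cardL phiE). Qed.
Lemma fvVK i : (i <= t)%N -> cancel (fun x : 'rV[L]_n => fv (t - i) x) (fun x => fv i x).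
Proof. by move=> le_it x; apply/matrixP => j k; rewrite !mxE (frobVK cardL phiE). Qed.

(* A subspace onto which both projections are surjective is the graph of a linear
   bijection [D]; meeting every [graph_line] makes [x D] proportional to the
   Frobenius image of [x], so that [semilinear_proportional] applies. *)
Lemma transversal_axis i (T : {set V}) :
  (0 < i < t)%N -> Lsubspace n n T ->
  (forall x, x != 0 -> exists v, [/\ v != 0, v \in graph_line i x & v \in T]) ->
  T = axis1 \/ T = axis2.
Proof.
move=> /andP[i0 it] TL Tx; have le_it := ltnW it.
have cT := card_Lsubspace TL.
case: (boolP [forall y : 'rV[L]_n, [exists v in T, v *m proj2 L n == y]]) => [f2|]; last first.
  rewrite negb_forall => /existsP[y yT]; left; apply/esym/eqP.
  rewrite eqEcard cT (card_Lsubspace axis1_Lsubspace) leqnn andbT.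
  (* If no vector of [T] has second projection [fv i x], the vector of [T] on the line of [x] must
     have b = 0, so the point of [axis1] over [x] is in [T]. One missed value suffices for all x:
     when [fv i x] is attained, [fv i (x + x0)] is missed, and x = (x + x0) - x0. *)
  have P1 x : ~~ [exists v in T, v *m proj2 L n == fv i x] -> emb x 0 \in T.
    move=> xT; have x0 : x != 0.
      apply: contraNneq xT => ->; apply/exists_inP; exists 0; first exact: Lsubspace0 TL.
      by rewrite mul0mx map_mx0.
    have [v [v0 /graph_lineP[a [b vE]] vT]] := Tx x x0; rewrite {v}vE in v0 vT.
    case: (eqVneq b 0) v0 vT => [->|b0] v0 vT; last first.
      case/exists_inP: xT; exists (b^-1 *: emb (a *: x) (b *: fv i x)).
        exact: LsubspaceZ TL _.
      by rewrite embZ emb_proj2 scalerK.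
    rewrite scale0r in v0 vT; have a0 : a != 0.
      by apply: contraNneq v0 => ->; rewrite scale0r emb0.
    by have := LsubspaceZ a^-1 TL vT; rewrite embZ scalerK // scaler0.
  pose x0 : 'rV[L]_n := fv (t - i) y.
  have x0E : fv i x0 = y by rewrite fvVK.
  have Tx0 : emb x0 0 \in T by apply: P1; rewrite x0E.
  apply/subsetP => _ /imsetP[x _ ->].
  case: (boolP [exists v in T, v *m proj2 L n == fv i x]) => [/exists_inP[v vT /eqP vE]|/P1 //].
  have /P1 : ~~ [exists v in T, v *m proj2 L n == fv i (x + x0)].
    apply: contra yT => /exists_inP[w wT /eqP wE]; apply/exists_inP; exists (w - v).
      exact: LsubspaceB TL _ _.
    by rewrite mulmxBl wE vE map_mxD addrC addKr x0E.
  by move/(LsubspaceB TL)/(_ Tx0); rewrite embB subr0 addrK.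
case: (boolP [forall y : 'rV[L]_n, [exists v in T, v *m proj1 L n == y]]) => [f1|]; last first.
  rewrite negb_forall => /existsP[y yT]; right; apply/esym/eqP.
  rewrite eqEcard cT (card_Lsubspace axis2_Lsubspace) leqnn andbT.
  have P2 x : ~~ [exists v in T, v *m proj1 L n == x] -> emb 0 (fv i x) \in T.
    move=> xT; have x0 : x != 0.
      apply: contraNneq xT => ->; apply/exists_inP; exists 0; first exact: Lsubspace0 TL.
      by rewrite mul0mx.
    have [v [v0 /graph_lineP[a [b vE]] vT]] := Tx x x0; rewrite {v}vE in v0 vT.
    case: (eqVneq a 0) v0 vT => [->|a0] v0 vT; last first.
      case/exists_inP: xT; exists (a^-1 *: emb (a *: x) (b *: fv i x)).
        exact: LsubspaceZ TL _.
      by rewrite embZ emb_proj1 scalerK.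
    rewrite scale0r in v0 vT; have b0 : b != 0.
      by apply: contraNneq v0 => ->; rewrite scale0r emb0.
    by have := LsubspaceZ b^-1 TL vT; rewrite embZ scalerK // scaler0.
  have Ty : emb 0 (fv i y) \in T by apply: P2.
  apply/subsetP => _ /imsetP[x' _ ->]; rewrite -(fvVK le_it x').
  move: (fv (t - i) x') => x.
  case: (boolP [exists v in T, v *m proj1 L n == x]) => [/exists_inP[v vT /eqP vE]|/P2 //].
  have /P2 : ~~ [exists v in T, v *m proj1 L n == x + y].
    apply: contra yT => /exists_inP[w wT /eqP wE]; apply/exists_inP; exists (w - v).
      exact: LsubspaceB TL _ _.
    by rewrite mulmxBl wE vE addrC addKr.
  by move/(LsubspaceB TL)/(_ Ty); rewrite embB subr0 map_mxD addrK.
(* [T] has as many elements as L^n, so surjectivity gives injectivity. *)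
have inj_of (P : 'M[L]_(2 * n, n)) :
    [forall y : 'rV[L]_n, [exists v in T, v *m P == y]] -> {in T &, injective (mulmx^~ P)}.
  move=> fP; apply/imset_injP; rewrite eqn_leq leq_imset_card cT.
  have <- : #|{: 'rV[L]_n}| = (#|L| ^ n)%N by rewrite card_mx mul1n.
  rewrite -cardsT; apply/subset_leq_card/subsetP => y _.
  by have /exists_inP[v vT /eqP <-] := forallP fP y; apply: imset_f.
have inj1T := inj_of _ f1; have inj2T := inj_of _ f2.
(* The linear section of [proj1] with values in [T]: its rows are the vectors of [T] above the
   standard basis. They exist by [f1], so the default 0 is never taken. *)
pose E := \matrix_(k < n) odflt 0 [pick v in T | v *m proj1 L n == delta_mx 0 k].
have ET x : x *m E \in T.
  rewrite mulmx_sum_row; apply: (big_ind (fun v => v \in T)).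
  - exact: Lsubspace0 TL.
  - by move=> u v; apply: LsubspaceD TL.
  - move=> k _; apply: (LsubspaceZ _ TL); rewrite rowK.
    by case: pickP => [v /andP[]|_] //=; apply: Lsubspace0 TL.
have E1 : E *m proj1 L n = 1%:M.
  apply/row_matrixP => k; rewrite row_mul rowK rowE mulmx1.
  case: pickP => [v /andP[_ /eqP //]|none].
  have /exists_inP[v vT vE] := forallP f1 (delta_mx 0 k).
  by have := none v; rewrite vT vE.
pose D := E *m proj2 L n.
have xE x : x *m E = emb x (x *m D).
  by rewrite -[LHS]emb_proj -!mulmxA E1 mulmx1.
have uD : D \in unitmx.
  apply: unitmx_injP => x xD0; have := ET x; rewrite xE xD0 => xT.
  have /emb_inj[] // : emb x 0 = emb 0 0.
  by apply: inj2T; rewrite ?emb0 ?(Lsubspace0 TL) //= -emb0 !emb_proj2.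
suff : (idfun : {rmorphism L -> L}) =1 frob i.
  move=> idE; have := frob_inj subK cardK cardL t_gt1 phiE (ltnW (leq_ltn_trans i0 it)) it idE.
  by move=> iE; rewrite -iE in i0.
apply: (semilinear_proportional n_gt1 uD) => x x0.
have [v [v0 /graph_lineP[a [b vE]] vT]] := Tx x x0; rewrite {v}vE in v0 vT.
have Ex : emb (a *: x) (b *: fv i x) = (a *: x) *m E.
  apply: inj1T => //=; rewrite ?ET //.
  by rewrite emb_proj1 -mulmxA E1 mulmx1.
move: Ex; rewrite xE => /emb_inj[_ Ex].
have a0 : a != 0.
  apply: contraNneq v0 => a0; move: Ex; rewrite a0 scale0r mul0mx => ->.
  by rewrite emb0.
exists (a^-1 * b); rewrite (map_mx_id (f := idfun)) //.
by rewrite -scalerA Ex -scalemxAl scalerK.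
Qed.

Lemma graph_linset_pseudoregulus i :
  (0 < i < t)%N -> coprime i t -> pseudoregulus K q t n (graph_linset i).
Proof.
move=> it cit; have [i0 lt_it] := andP it; have le_it := ltnW lt_it.
apply/existsP; exists (graph_set i); apply/and5P; split=> //.
- exact: graph_set_Fq_subspace.
- by rewrite card_graph_set.
- exact: graph_set_scattered.
apply/existsP; exists (graph_lines i); apply/and4P; split.
- by rewrite card_graph_lines.
- apply/forall_inP => _ /imsetP[x + ->]; rewrite inE => x0.
  apply/andP; split; first exact: graph_line_Lsubspace.
  by apply/eqP/card_graph_lineI.
- apply/forall_inP => _ /imsetP[x + ->]; rewrite inE => x0.
  apply/forall_inP => _ /imsetP[y + ->]; rewrite inE => y0.
  apply/implyP => xy; rewrite eqEsubset; apply/andP; split; apply/subsetP => v.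
    rewrite !inE => /andP[vx vy]; apply: contraNT xy => v0.
    have [c c0 ->] := graph_line_meet le_it x0 y0 v0 vx vy.
    by rewrite graph_lineZ.
  rewrite inE => /eqP->; rewrite inE.
  by rewrite (Lsubspace0 (graph_line_Lsubspace i x0)) (Lsubspace0 (graph_line_Lsubspace i y0)).
suff -> : [set T | [&& Lsubspace n n T, T :&: graph_linset i == set0
    & [forall s in graph_lines i, exists v, [&& v != 0, v \in s & v \in T]]]]
    = [set axis1; axis2].
  by rewrite cards2 axis1_neq_axis2.
apply/setP => T; rewrite !inE; apply/and3P/orP => [[TL _ /forall_inP Ts]|].
  have [|->|->] := @transversal_axis i T it TL; rewrite ?eqxx; [|by left|by right].
  move=> x x0.
  have /existsP[v /and3P[? ? ?]] : [exists v, [&& v != 0, v \in graph_line i x & v \in T]].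
    by apply: Ts; apply: imset_f; rewrite inE.
  by exists v.
case=> /eqP->.
- split; first exact: axis1_Lsubspace.
    by rewrite axis1_linset.
  apply/forall_inP => _ /imsetP[x + ->]; rewrite inE => x0; apply/existsP.
  exists (emb x 0); rewrite graph_line_axis1 emb_eq0 negb_and x0 /=.
  exact: imset_f.
- split; first exact: axis2_Lsubspace.
    by rewrite axis2_linset.
  apply/forall_inP => _ /imsetP[x + ->]; rewrite inE => x0; apply/existsP.
  exists (emb 0 (fv i x)); rewrite graph_line_axis2 emb_eq0 negb_and map_mx_eq0_rV x0 orbT /=.
  exact: imset_f.
Qed.

(** * Counting on lines, and collineations between canonical sets *)

Lemma imset_mulmxK (M : 'M[L]_(2 * n)) (X Y : {set V}) :
  M \in unitmx -> Y = [set v *m M | v in X] -> X = [set v *m invmx M | v in Y].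
Proof.
move=> uM ->; apply/setP => v; apply/idP/imsetP => [Xv|[_ /imsetP[w Xw ->] ->]].
  by exists (v *m M); [apply: imset_f | rewrite mulmxK].
by rewrite mulmxK.
Qed.

(** The vectors a (b x, (b x)^(q^i)) with a, b nonzero all lie in the intersection. Two pairs give
    the same vector exactly when they differ by (a, b) -> (a/k, k b) with k nonzero in [K], so each
    vector is hit q - 1 times. *)
Lemma card_graph_lineI_linset i x :
  (i <= t)%N -> coprime i t -> x != 0 ->
  ((q ^ t - 1) ^ 2 <= #|graph_line i x :&: graph_linset i| * (q - 1))%N.
Proof.
move=> le_it cit x0.
pose D : {set L * L} := setX [set a | a != 0] [set a | a != 0].
pose f (p : L * L) := p.1 *: graph i (p.2 *: x).
have DE : #|D| = ((q ^ t - 1) ^ 2)%N by rewrite cardsX cards_neq0 cardL subn1 mulnn.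
rewrite -DE (@card_imset_fibers _ _ f D (q - 1)).
  rewrite leq_mul2r; apply/orP; right; apply/subset_leq_card/subsetP => v /imsetP[[a b] Dab {v}->].
  have /andP[a0 b0] : (a != 0) && (b != 0) by move: Dab; rewrite !inE.
  rewrite in_setI; apply/andP; split.
    exact: LsubspaceZ (graph_line_Lsubspace i x0) (graph_line_graph _ _ _).
  by apply/graph_linsetP; exists a, (b *: x); rewrite scaler_eq0 negb_or b0 x0.
move=> [a b]; rewrite !inE /= => /andP[a0 b0].
have <- : #|[set k in K | k != 0]| = (q - 1)%N.
  rewrite -cardK (cardsD1 0 K) (subfield0 subK) addKn; apply: eq_card => k.
  by rewrite !inE andbC.
rewrite -(card_imset _ (f := fun k => (k^-1 * a, k * b))); last first.
  by move=> k l [_ /(mulIf b0)].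
apply: eq_card => -[c d]; rewrite inE; apply/andP/imsetP; last first.
  case=> k; rewrite inE => /andP[Kk k0] [-> ->]; rewrite !inE /=.
  rewrite !mulf_neq0 ?invr_eq0 //; split=> //; apply/eqP.
  rewrite /f /= -[k * b *: x]scalerA -graphZ ?(frob_subfield subK cardK phiE) //.
  by rewrite scalerA mulrAC mulVf // mul1r.
rewrite !inE /= => -[/andP[c0 d0] /eqP].
rewrite /f /= /graph !embZ => /emb_inj[].
rewrite !scalerA !map_mxZ !scalerA => /eqP.
rewrite -subr_eq0 -scalerBl scaler_eq0 (negPf x0) orbF subr_eq0 => /eqP E1 /eqP.
rewrite -subr_eq0 -scalerBl scaler_eq0 map_mx_eq0_rV (negPf x0) orbF subr_eq0 /= => /eqP E2.
have Kk : d / b \in K.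
  apply: (frob_fix_coprime subK cardK cardL t_gt1 phiE cit).
  rewrite rmorphM fmorphV /=.
  have fb0 : frob i b != 0 by rewrite fmorph_eq0.
  apply: (mulIf fb0); rewrite divfK //.
  apply: (mulfI c0); rewrite E2; apply: (mulIf b0).
  have -> : c * (d / b * frob i b) * b = c * d * frob i b by field.
  by rewrite E1 mulrAC.
exists (d / b); first by rewrite inE Kk mulf_neq0 ?invr_eq0.
congr (_, _); last by rewrite divfK.
by rewrite invf_div; apply: (mulIf d0); rewrite E1 mulrAC divfK // mulrC.
Qed.

(** As y and z are independent, comparing the two coordinates of a graph vector on the line shows
    that its coefficients are fixed by [frob j], hence lie in [K]. The points form a K-subline,
    parametrised by K with a point at infinity ([None]); the bound q^t per point also admits the
    scalar 0. *)
Lemma card_lineI_linset j y z :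
  (j <= t)%N -> coprime j t -> y != 0 -> (forall c, z <> c *: y) ->
  (#|lincomb2 (graph j y) (graph j z) :&: graph_linset j| <= q.+1 * q ^ t)%N.
Proof.
move=> le_jt cjt y0 zy.
pose f (p : option L * L) : V :=
  p.2 *: (if p.1 is Some k then graph j y + k *: graph j z else graph j z).
pose D : {set option L * L} := setX (None |: [set Some k | k in K]) [set: L].
have DE : #|D| = (q.+1 * q ^ t)%N.
  rewrite cardsX cardsT cardL cardsU1 card_imset ?cardK; last by move=> ? ? [].
  by case: imsetP => [[]|].
rewrite -DE; apply: leq_trans (leq_imset_card f D); apply/subset_leq_card/subsetP => v.
rewrite inE => /andP[/lincomb2P[a [b vE]] /graph_linsetP[c [w [c0 w0 vE']]]].
have : graph j w = emb ((c^-1 * a) *: y + (c^-1 * b) *: z)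
    ((c^-1 * a) *: fv j y + (c^-1 * b) *: fv j z).
  rewrite -[LHS](scalerK c0) -vE' vE scalerDr !scalerA -embD -!embZ //.
move: vE; have -> : a = c * (c^-1 * a) by rewrite mulVKf.
have -> : b = c * (c^-1 * b) by rewrite mulVKf.
rewrite !mulKf //; move: (c^-1 * a) (c^-1 * b) => {}a {}b vE /emb_inj[->].
rewrite map_mxD !map_mxZ /= => /eqP; rewrite -subr_eq0 opprD addrACA -!scalerBl => /eqP.
have zy' d : fv j z <> d *: fv j y by move/(frob_proportional le_jt)/zy.
have fy0 : fv j y != 0 by rewrite map_mx_eq0_rV.
have indep (a' b' : L) : a' *: fv j y + b' *: fv j z = 0 -> a' = 0 /\ b' = 0.
  case: (eqVneq b' 0) => [->|b0 E].
    by rewrite scale0r addr0 => /eqP; rewrite scaler_eq0 (negPf fy0) orbF => /eqP.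
  case: (zy' (- (b'^-1 * a'))); apply: (scalerI b0).
  rewrite scalerA mulrN mulVKf // scaleNr; apply/eqP; rewrite -addr_eq0 addrC E //.
case/indep => /subr0_eq/(frob_fix_coprime subK cardK cardL t_gt1 phiE cjt) Ka.
move=> /subr0_eq/(frob_fix_coprime subK cardK cardL t_gt1 phiE cjt) Kb.
apply/imsetP; rewrite vE; case: (eqVneq a 0) => [->|a0].
  exists (None, c * b); first by rewrite !inE.
  by rewrite /f /= mulr0 scale0r add0r.
exists (Some (a^-1 * b), c * a).
  rewrite !inE /= andbT; apply: imset_f.
  by apply: (subfieldM subK) => //; apply: (subfieldV subK).
by rewrite /f /= [RHS]scalerDr scalerA -mulrA mulVKf.
Qed.

Lemma not_subfield_exists : exists a, a \notin K.
Proof.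
have [a _ aK] : exists2 a, a \in [set: L] & a \notin K; last by exists a.
apply/subsetPn; apply/negP => /subset_leq_card; rewrite cardsT cardK cardL leqNgt.
by rewrite -{1}[q]expn1 ltn_exp2l ?q_gt1 ?t_gt1.
Qed.

(* A line with two points of the linear set off the lines [graph_line] meets it in
   a subline over K, which has fewer points than a [graph_line] since [2 < t]. *)
Lemma graph_line_imset i j x (M : 'M[L]_(2 * n)) :
  (2 < t)%N -> (i <= t)%N -> coprime i t -> (j <= t)%N -> coprime j t ->
  M \in unitmx -> graph_linset j = [set v *m M | v in graph_linset i] -> x != 0 ->
  exists2 y, y != 0 & [set v *m M | v in graph_line i x] = graph_line j y.
Proof.
move=> t_gt2 le_it cit le_jt cjt uM AM x0; set s := imset _ _.
have sL : Lsubspace n 2 s := Lsubspace_imset uM (graph_line_Lsubspace i x0).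
have img a : a != 0 -> exists c y, [/\ c != 0, y != 0, graph j y \in s &
    graph i (a *: x) *m M = c *: graph j y].
  move=> a0; have : graph i (a *: x) *m M \in graph_linset j.
    by rewrite AM; apply/imset_f/graph_in_linset; rewrite scaler_eq0 negb_or a0.
  case/graph_linsetP => c [y [c0 y0 E]]; exists c, y; split=> //.
  have -> : graph j y = c^-1 *: (graph i (a *: x) *m M) by rewrite E scalerK.
  by apply: LsubspaceZ sL _; apply/imset_f/graph_line_graph.
have [c [y [c0 y0 ys E1]]] := img 1 (oner_neq0 _).
have gy0 : graph j y != 0 by rewrite graph_eq0.
(* Either all graph vectors in [s] lie over multiples of y, and then the images for the scalars 1
   and a outside [K] are two distinct points common to [s] and [graph_line j y]; or [s] meets the
   linear set in a subline, against the count. *)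
have [/forallP all_y|] := boolP [forall z, (graph j z \in s) ==> [exists c, z == c *: y]].
  exists y => //; have [a aK] := not_subfield_exists.
  have a0 : a != 0 by apply: contraNneq aK => ->; exact: subfield0 subK.
  have [d [z [d0 z0 zs E2]]] := img a a0.
  have /existsP[e /eqP zE] := implyP (all_y z) zs.
  have indep f : graph j z <> f *: graph j y.
    move=> fE; move: E2; rewrite fE -[graph j y](scalerK c0) -E1 !scalemxAl.
    move/(can_inj (mulmxK uM)); rewrite scale1r /graph !embZ map_mxZ => /emb_inj[].
    rewrite !scalerA => /(scaler_inj_r x0) <- /=; apply/eqP.
    rewrite (inj_eq (scaler_inj_r _)) ?map_mx_eq0_rV //; apply: contraNneq aK => E.
    by apply: (frob_fix_coprime subK cardK cardL t_gt1 phiE cit).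
  rewrite (line_lincomb2 sL ys zs gy0 indep).
  apply/esym/line_lincomb2 => //; first exact: graph_line_Lsubspace.
    by rewrite -[y in graph j y]scale1r graph_line_graph.
  by rewrite zE graph_line_graph.
rewrite negb_forall => /existsP[z]; rewrite negb_imply => /andP[zs /existsP zy].
have zy' e : z <> e *: y by move/eqP=> zE; apply: zy; exists e.
have sE : s = lincomb2 (graph j y) (graph j z).
  by apply: line_lincomb2 => // e; rewrite /graph embZ => /emb_inj[/zy'].
have ub := card_lineI_linset le_jt cjt y0 zy'.
have lb := card_graph_lineI_linset le_it cit x0.
have cE : #|s :&: graph_linset j| = #|graph_line i x :&: graph_linset i|.
  rewrite AM -imsetI; last by move=> u v _ _; apply: (can_inj (mulmxK uM)).
  by rewrite card_imset //; apply: (can_inj (mulmxK uM)).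
rewrite -sE cE in ub; exfalso.
have q1 := q_gt1; have Qq : (q ^ 3 <= q ^ t)%N by rewrite leq_exp2l.
have {}lb : ((q ^ t - 1) ^ 2 <= q.+1 * q ^ t * (q - 1))%N.
  by apply: leq_trans lb _; rewrite leq_mul2r ub orbT.
by move: lb; rewrite leqNgt sublineI_card_lt.
Qed.

(** The image still meets every line [graph_line j y], because the inverse collineation takes that
    line to some [graph_line i x], which meets [T]. Hence it is one of the only two such
    subspaces. *)
Lemma axis_imset i j (M : 'M[L]_(2 * n)) (T : {set V}) :
  (2 < t)%N -> (0 < i < t)%N -> coprime i t -> (0 < j < t)%N -> coprime j t ->
  M \in unitmx -> graph_linset j = [set v *m M | v in graph_linset i] ->
  T = axis1 \/ T = axis2 ->
  [set v *m M | v in T] = axis1 \/ [set v *m M | v in T] = axis2.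
Proof.
move=> t_gt2 it cit jt cjt uM AM T12; have [/andP[i0 lt_it] /andP[j0 lt_jt]] := (it, jt).
apply: (transversal_axis jt).
  apply: Lsubspace_imset uM _.
  by case: T12 => ->; [exact: axis1_Lsubspace | exact: axis2_Lsubspace].
move=> y y0.
have uM' : invmx M \in unitmx by rewrite unitmx_inv.
have [x x0 xE] := graph_line_imset t_gt2 (ltnW lt_jt) cjt (ltnW lt_it) cit uM'
  (imset_mulmxK uM AM) y0.
have [v v0 [vx vT]] : exists2 v, v != 0 & v \in graph_line i x /\ v \in T.
  case: T12 => ->.
    exists (emb x 0); first by rewrite emb_eq0 negb_and x0.
    by split; [exact: graph_line_axis1 | exact: imset_f].
  exists (emb 0 (fv i x)); first by rewrite emb_eq0 negb_and map_mx_eq0_rV x0 orbT.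
  by split; [exact: graph_line_axis2 | exact: imset_f].
exists (v *m M); split; last exact: imset_f.
  by rewrite -(mul0mx _ M) (inj_eq (can_inj (mulmxK uM))).
by move: vx; rewrite -xE => /imsetP[w wy ->]; rewrite mulmxKV.
Qed.

Lemma graph_linset_imset_inv i j (M : 'M[L]_(2 * n)) :
  (2 < t)%N -> (0 < i < t)%N -> coprime i t -> (0 < j < t)%N -> coprime j t ->
  M \in unitmx -> graph_linset j = [set v *m M | v in graph_linset i] ->
  j = i \/ j = (t - i)%N.
Proof.
move=> t_gt2 it cit jt cjt uM AM; have [/andP[i0 lt_it] /andP[j0 lt_jt]] := (it, jt).
have M_inj : injective (fun v : V => v *m M) := can_inj (mulmxK uM).
have ax T := axis_imset t_gt2 it cit jt cjt uM AM (T := T).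
have graphM x : x != 0 -> exists c y, [/\ c != 0, y != 0 & graph i x *m M = c *: graph j y].
  move=> x0; have : graph i x *m M \in graph_linset j.
    by rewrite AM; apply/imset_f/graph_in_linset.
  by case/graph_linsetP => c [y [? ? ?]]; exists c, y.
have neq12 T : [set v *m M | v in axis1] = T -> [set v *m M | v in axis2] = T -> False.
  by move=> <- /(imset_inj M_inj)/esym/eqP; rewrite (negPf axis1_neq_axis2).
pose B1 := inj1 L n *m M *m proj1 L n; pose B2 := inj1 L n *m M *m proj2 L n.
pose C1 := inj2 L n *m M *m proj1 L n; pose C2 := inj2 L n *m M *m proj2 L n.
have e1 x : emb x 0 = x *m inj1 L n by rewrite /emb mul0mx addr0.
have e2 x : emb 0 x = x *m inj2 L n by rewrite /emb mul0mx add0r.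
have M1 x : emb x 0 *m M = emb (x *m B1) (x *m B2).
  by rewrite -[LHS]emb_proj e1 !mulmxA.
have M2 x : emb 0 x *m M = emb (x *m C1) (x *m C2).
  by rewrite -[LHS]emb_proj e2 !mulmxA.
have gM x : graph i x *m M = emb (x *m B1 + fv i x *m C1) (x *m B2 + fv i x *m C2).
  rewrite -embD -M1 -M2 -mulmxDl embD addr0 add0r //.
have inj_emb1 x : emb x 0 *m M = 0 -> x = 0.
  by rewrite -(mul0mx _ M) => /M_inj; rewrite -(emb0 L n) => /emb_inj[].
have inj_emb2 x : emb 0 x *m M = 0 -> x = 0.
  by rewrite -(mul0mx _ M) => /M_inj; rewrite -(emb0 L n) => /emb_inj[].
have [A1|A1] := ax _ (or_introl erefl).
  have A2 : [set v *m M | v in axis2] = axis2.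
    by have [A2|] := ax _ (or_intror erefl); [case: (neq12 _ A1 A2)|].
  have B20 (x : 'rV_n) : x *m B2 = 0.
    have : emb x 0 *m M \in axis1 by rewrite -A1; apply/imset_f/imset_f.
    by move/axis1P; rewrite M1 emb_proj2.
  have C10 (x : 'rV_n) : x *m C1 = 0.
    have : emb 0 x *m M \in axis2 by rewrite -A2; apply/imset_f/imset_f.
    by move/axis2P; rewrite M2 emb_proj1.
  have uB1 : B1 \in unitmx.
    by apply: unitmx_injP => x xB; apply: inj_emb1; rewrite M1 xB B20 emb0.
  have uC2 : C2 \in unitmx.
    by apply: unitmx_injP => x xC; apply: inj_emb2; rewrite M2 xC C10 emb0.
  left; apply/esym/(frob_inj subK cardK cardL t_gt1 phiE lt_it lt_jt).
  (* With M block diagonal, (x, x^(q^i)) goes to (x B1, x^(q^i) C2). Being on a multiple of the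
     second graph, its second entry is proportional to (x B1)^(q^j), whence this matrix relating
     [frob i] to [frob j]. *)
  have uD : C2 *m invmx (fv j B1) \in unitmx.
    by rewrite unitmx_mul uC2 unitmx_inv map_unitmx.
  apply: (semilinear_proportional n_gt1 uD) => x x0.
  have [c [y [c0 y0]]] := graphM x x0.
  rewrite gM B20 C10 addr0 add0r embZ => /emb_inj[E1 E2].
  have yE : y = c^-1 *: (x *m B1) by rewrite E1 scalerK.
  exists (c * frob j c^-1); rewrite mulmxA E2 yE map_mxZ map_mxM scalerA.
  by rewrite -scalemxAl mulmxK // map_unitmx.
have A2 : [set v *m M | v in axis2] = axis1.
  by have [|A2] := ax _ (or_intror erefl); [|case: (neq12 _ A1 A2)].
have B10 (x : 'rV_n) : x *m B1 = 0.
  have : emb x 0 *m M \in axis2 by rewrite -A1; apply/imset_f/imset_f.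
  by move/axis2P; rewrite M1 emb_proj1.
have C20 (x : 'rV_n) : x *m C2 = 0.
  have : emb 0 x *m M \in axis1 by rewrite -A2; apply/imset_f/imset_f.
  by move/axis1P; rewrite M2 emb_proj2.
have uB2 : B2 \in unitmx.
  by apply: unitmx_injP => x xB; apply: inj_emb1; rewrite M1 xB B10 emb0.
have uC1 : C1 \in unitmx.
  by apply: unitmx_injP => x xC; apply: inj_emb2; rewrite M2 xC C20 emb0.
have uD : B2 *m invmx (fv j C1) \in unitmx.
  by rewrite unitmx_mul uB2 unitmx_inv map_unitmx.
(* In the exchanged case the first entry is x^(q^i) C1, so x B2 is proportional to its image under
   [frob j]: the two Frobenius powers compose. *)
have ijE : (idfun : {rmorphism L -> L}) =1 frob (j + i).
  apply: (semilinear_proportional n_gt1 uD) => x x0.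
  have [c [y [c0 y0]]] := graphM x x0.
  rewrite gM B10 C20 addr0 add0r embZ => /emb_inj[E1 E2].
  have yE : y = c^-1 *: (fv i x *m C1) by rewrite E1 scalerK.
  exists (c * frob j c^-1); rewrite (map_mx_id (f := idfun)) //.
  rewrite mulmxA E2 yE map_mxZ map_mxM scalerA -scalemxAl mulmxK ?map_unitmx //.
  by congr (_ *: _); apply/matrixP => k l; rewrite !mxE /= frobD.
right; apply: (frob_inj subK cardK cardL t_gt1 phiE lt_jt); first by lia.
move=> x; rewrite -[x in RHS]/(idfun x) ijE addnC -frobD.
by rewrite (frobK cardL phiE (ltnW lt_it)).
Qed.

Definition swap_mx : 'M[L]_(2 * n) := proj1 L n *m inj2 L n + proj2 L n *m inj1 L n.

Lemma emb_swap x y : emb x y *m swap_mx = emb y x.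
Proof. by rewrite mulmxDr !mulmxA emb_proj1 emb_proj2 addrC. Qed.

Lemma swap_mx_unit : swap_mx \in unitmx.
Proof.
apply: unitmx_injP => v; rewrite -(emb_proj v) emb_swap => /eqP.
by rewrite emb_eq0 andbC -emb_eq0 => /eqP.
Qed.

(** Put y = x^(q^i): the exchanged vector (x^(q^i), x) is (y, y^(q^(t-i))). *)
Lemma graph_linset_swap i :
  (i <= t)%N -> graph_linset (t - i) = [set v *m swap_mx | v in graph_linset i].
Proof.
move=> le_it; apply/setP => v; apply/graph_linsetP/imsetP.
  case=> a [x [a0 x0 ->]]; exists (a *: graph i (fv (t - i) x)).
    by apply/graph_linsetP; exists a, (fv (t - i) x); rewrite map_mx_eq0_rV.
  by rewrite -scalemxAl /graph emb_swap fvVK.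
case=> _ /graph_linsetP[a [x [a0 x0 ->]]] ->; exists a, (fv i x).
by rewrite map_mx_eq0_rV -scalemxAl /graph emb_swap fvK.
Qed.
End Canonical.

(** * Semilinearity and collineations *)


(** Double counting of incidences between [S] and the nonzero elements of [X]: each member
    contributes at least c, each element is counted at most once, and an uncovered v would leave one
    element too few. *)
Lemma disjoint_cover (V : finZmodType) (S : {set {set V}}) (X : {set V}) c :
  0 \in X -> {in S &, forall s1 s2 : {set V}, s1 != s2 -> s1 :&: s2 = [set 0]} ->
  {in S, forall s : {set V}, (0 \in s) && (c < #|s :&: X|)%N} -> (#|X| <= (#|S| * c).+1)%N ->
  {in X, forall v, v != 0 -> exists2 s, s \in S & v \in s}.
Proof.
move=> X0 Sdis Sc cX v Xv v0; apply/exists_inP; apply: contraT.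
rewrite negb_exists_in => /forall_inP vS.
set Y := X :\ 0; have YE u : (u \in Y) = (u != 0) && (u \in X) by rewrite !inE.
have lb : (#|S| * c <= \sum_(s in S) \sum_(u in Y) (u \in s))%N.
  rewrite -sum_nat_const; apply: leq_sum => s Ss; have /andP[s0 cs] := Sc s Ss.
  rewrite -big_mkcondr sum1_card -ltnS; apply: leq_trans cs _.
  rewrite (cardsD1 0) in_setI s0 X0 /= add1n ltnS; apply/subset_leq_card/subsetP => u.
  rewrite in_setD1 in_setI => /and3P[u0 us uX].
  by rewrite unfold_in /= YE u0 uX us.
have ub : (\sum_(s in S) \sum_(u in Y) (u \in s) <= #|Y :\ v|)%N.
  rewrite exchange_big /= (big_setD1 v) /=; last by rewrite YE v0.
  rewrite big1 => [|s Ss]; last by rewrite (negPf (vS s Ss)).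
  rewrite add0n -sum1_card; apply: leq_sum => u; rewrite !inE => /and3P[_ u0 _].
  rewrite -big_mkcondr sum1_card; apply/card_le1_eqP => s1 s2.
  move=> /andP[S1 us1] /andP[S2 us2]; apply/eqP; apply: contraNT u0 => s12.
  by rewrite -in_set1 -(Sdis _ _ S2 S1 s12) inE us2.
move: cX; rewrite (cardsD1 0 X) X0 -/Y (cardsD1 v) YE v0 Xv !add1n ltnS ltnNge.
by rewrite (leq_trans lb ub).
Qed.

(* The special case of the fundamental theorem of projective geometry for additive
   bijections: the scalars at [e_k] and [e_l] agree since [e_k + e_l] is also
   mapped into its span, and [b e_0 + e_1] yields multiplicativity. *)
Lemma point_preserving_semilinear (L : finFieldType) n (F : 'rV[L]_n -> 'rV[L]_n) :
  (1 < n)%N -> injective F -> {morph F : x y / x + y} ->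
  (forall a x, exists b, F (a *: x) = b *: F x) ->
  exists s : {rmorphism L -> L}, exists2 D, D \in unitmx & forall x, F x = map_mx s x *m D.
Proof.
case: n F => [|[|m]] // F _ F_inj FD Fpt; set n := m.+2 in F F_inj FD Fpt *.
pose e (k : 'I_n) : 'rV[L]_n := delta_mx 0 k.
have F0 : F 0 = 0 by apply: (addrI (F 0)); rewrite -FD !addr0.
have Fsum x : F x = \sum_k F (x 0 k *: e k).
  by rewrite {1}[x]row_sum_delta (big_morph F FD F0).
pose D := \matrix_k F (e k).
have uD : D \in unitmx.
  rewrite -row_full_unit -sub1mx; apply/row_subP => k.
  have /injF_bij[G _ GK] := F_inj; rewrite -(GK (row k 1%:M)) Fsum.
  apply: summx_sub => l _; have [b ->] := Fpt (G (row k 1%:M) 0 l) (e l).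
  by apply: scalemx_sub; rewrite -[F (e l)](rowK (fun l => F (e l))) row_sub.
pose G x := F x *m invmx D.
have GD x y : G (x + y) = G x + G y by rewrite /G FD mulmxDl.
have G0 : G 0 = 0 by rewrite /G F0 mul0mx.
have Gpt a x : exists b, G (a *: x) = b *: G x.
  by have [b E] := Fpt a x; exists b; rewrite /G E scalemxAl.
have Ge k : G (e k) = e k.
  by rewrite /G -[F (e k)](rowK (fun l => F (e l))) -/D -row_mul mulmxV // rowE mulmx1.
pose s k a := G (a *: e k) 0 k.
have Gs a k : G (a *: e k) = s k a *: e k.
  by rewrite /s; have [b ->] := Gpt a (e k); rewrite Ge !mxE !eqxx mulr1.
have GE x k : G x 0 k = s k (x 0 k).
  rewrite {1}[x]row_sum_delta (big_morph G GD G0) summxE (bigD1 k) //= Gs.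
  rewrite big1 => [|l lk]; first by rewrite !mxE !eqxx mulr1 addr0.
  by rewrite Gs !mxE eqxx eq_sym (negPf lk) mulr0.
have sk k a : s k a = s ord0 a.
  case: (eqVneq k ord0) => [->//|k0].
  have [c /matrixP Ec] := Gpt a (e ord0 + e k).
  have := Ec 0 k; have := Ec 0 ord0; rewrite !GE GD !Ge !mxE !eqxx (negPf k0).
  by rewrite eq_sym (negPf k0) /= addr0 add0r !mulr1 => -> ->.
pose f := s ord0.
have {}GE x : G x = map_mx f x by apply/rowP => k; rewrite GE sk [RHS]mxE.
have fD : zmod_morphism f.
  have f0 : f 0 = 0 by rewrite /f /s scale0r G0 mxE.
  have fadd a b : f (a + b) = f a + f b by rewrite /f /s scalerDl GD mxE.
  by move=> a b; apply: (addIr (f b)); rewrite -fadd !subrK.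
have f1 : f 1 = 1 by rewrite /f /s scale1r Ge mxE !eqxx.
have fM : monoid_morphism f.
  split=> // a b; have [c] := Gpt a (b *: e ord0 + e (lift ord0 ord0)).
  rewrite !GE => /matrixP Ec; have := Ec 0 (lift ord0 ord0); have := Ec 0 ord0.
  by rewrite !mxE /= !mulr0 !addr0 !add0r !mulr1 f1 mulr1 => -> ->.
pose r : {rmorphism L -> L} := HB.pack f
  (GRing.isZmodMorphism.Build _ _ _ fD) (GRing.isMonoidMorphism.Build _ _ _ fM).
exists r, D => // x; rewrite -[map_mx r x]/(map_mx f x) -GE /G mulmxKV //.
Qed.

Section Collineations.
Variables (L : finFieldType) (n : nat).
Implicit Types A B C U : {set 'rV[L]_(2 * n)}.

Lemma coll_equivP A B :
  reflect (exists (f : {rmorphism L -> L}) (M : 'M[L]_(2 * n)),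
             M \in unitmx /\ B = [set map_mx f v *m M | v in A])
          (coll_equiv n A B).
Proof.
apply: (iffP existsP) => [[s /existsP[M /and3P[/and4P[_ sD sM /eqP s1] uM /eqP ->]]]|].
  have fD : zmod_morphism s.
    have sadd a b : s (a + b) = s a + s b by apply/eqP/(forallP (forallP sD a)).
    by move=> a b; apply: (addIr (s b)); rewrite -sadd !subrK.
  have fM : monoid_morphism s.
    by split=> // a b; apply/eqP/(forallP (forallP sM a)).
  pose f : {rmorphism L -> L} := HB.pack (s : L -> L)
    (GRing.isZmodMorphism.Build _ _ _ fD) (GRing.isMonoidMorphism.Build _ _ _ fM).
  by exists f, M.
case=> f [M [uM ->]]; exists [ffun x => f x]; apply/existsP; exists M.
rewrite uM /=; apply/andP; split; last first.
  by apply/eqP/eq_imset => v; congr (_ *m _); apply/matrixP => k l; rewrite !mxE ffunE.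
apply/and4P; split.
- by apply/injectiveP => x y; rewrite !ffunE => /fmorph_inj.
- by apply/forallP => x; apply/forallP => y; rewrite !ffunE rmorphD.
- by apply/forallP => x; apply/forallP => y; rewrite !ffunE rmorphM.
- by rewrite ffunE rmorph1.
Qed.

(** The inverse is a power of [f], since [f] permutes a finite set; as an iterate it is a morphism
    at once. *)
Lemma fin_rmorph_inv (f : {rmorphism L -> L}) : exists g : {rmorphism L -> L}, cancel f g.
Proof.
pose p := perm (@fmorph_inj _ _ f).
exists (rmorph_iter f #[p]%g.-1) => x.
rewrite -[LHS]/(iter #[p]%g.-1 f (f x)) -iterSr (prednK (order_gt0 p)).
have <- : (p ^+ #[p])%g x = iter #[p]%g f x.
  by rewrite permX; apply: eq_iter => y; rewrite permE.
by rewrite expg_order perm1.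
Qed.

Lemma coll_equiv_refl A : coll_equiv n A A.
Proof.
apply/coll_equivP; exists idfun, 1%:M; split; first exact: unitmx1.
rewrite -[LHS]imset_id; apply: eq_imset => v.
by rewrite mulmx1 map_mx_id.
Qed.

Lemma coll_equiv_imset A (M : 'M[L]_(2 * n)) :
  M \in unitmx -> coll_equiv n A [set v *m M | v in A].
Proof.
move=> uM; apply/coll_equivP; exists idfun, M; split=> //.
by apply: eq_imset => v; rewrite map_mx_id.
Qed.

Lemma coll_equiv_sym A B : coll_equiv n A B -> coll_equiv n B A.
Proof.
case/coll_equivP=> f [M [uM ->]]; have [g fK] := fin_rmorph_inv f.
apply/coll_equivP; exists g, (map_mx g (invmx M)); split.
  by rewrite map_unitmx unitmx_inv.
have E v : map_mx g (map_mx f v *m M) *m map_mx g (invmx M) = v.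
  by rewrite -map_mxM mulmxK //; apply/matrixP => k l; rewrite !mxE fK.
apply/setP => v; apply/idP/imsetP => [Av|[_ /imsetP[w Aw ->] ->]]; last by rewrite E.
by exists (map_mx f v *m M); rewrite ?E //; apply: imset_f.
Qed.

Lemma coll_equiv_trans A B C : coll_equiv n A B -> coll_equiv n B C -> coll_equiv n A C.
Proof.
case/coll_equivP=> f [M [uM ->]] /coll_equivP[g [N [uN ->]]].
apply/coll_equivP; exists (g \o f : {rmorphism L -> L}), (map_mx g M *m N).
split; first by rewrite unitmx_mul map_unitmx uM.
rewrite -imset_comp; apply: eq_imset => v /=.
by rewrite map_mxM mulmxA map_mx_comp.
Qed.

Lemma linset_imset U (M : 'M[L]_(2 * n)) :
  M \in unitmx -> linset n [set u *m M | u in U] = [set v *m M | v in linset n U].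
Proof.
move=> uM; have M_eq0 u : (u *m M == 0) = (u == 0).
  by rewrite -[in LHS](mul0mx _ M) (inj_eq (can_inj (mulmxK uM))).
apply/setP => v; apply/linsetP/imsetP.
  case=> _ /imsetP[u Uu ->]; rewrite M_eq0 => -[u0 [a a0 ->]].
  exists (a *: u); last by rewrite scalemxAl.
  by apply/linsetP; exists u; last by split=> //; exists a.
case=> _ /linsetP[u Uu [u0 [a a0 ->]]] ->; exists (u *m M); first exact: imset_f.
by rewrite M_eq0 u0; split=> //; exists a; rewrite ?scalemxAl.
Qed.
End Collineations.

(** * Canonical form *)

Section CanonicalForm.
Variables (L : finFieldType) (K : {set L}) (q t n : nat).
Hypothesis subK : is_subfield K.
Hypothesis cardK : #|K| = q.
Hypothesis cardL : #|L| = (q ^ t)%N.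
Hypothesis t_gt1 : (1 < t)%N.
Variable phi : {rmorphism L -> L}.
Hypothesis phiE : forall x, phi x = x ^+ q.
Hypothesis n_gt1 : (1 < n)%N.

Local Notation frob i := (rmorph_iter phi i).
Local Notation fv i x := (map_mx (rmorph_iter phi i) x).
Local Notation q_gt1 := (subfield_card_gt1 subK cardK).
Local Notation V := 'rV[L]_(2 * n).

Section Transversals.
Variables (U : {set V}) (S : {set {set V}}).
Hypothesis subU : Fq_subspace K n U.
Hypothesis cardU : #|U| = (q ^ (t * n))%N.
Hypothesis scU : scattered q n U.
Hypothesis cardS : #|S| = ((q ^ (n * t) - 1) %/ (q ^ t - 1))%N.
Hypothesis lineS : {in S, forall s : {set V}, Lsubspace n 2 s /\ #|s :&: U| = (q ^ t)%N}.
Hypothesis disjS : {in S &, forall s1 s2 : {set V}, s1 != s2 -> s1 :&: s2 = [set 0]}.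

Lemma Fq0 : 0 \in U. Proof. by case/and3P: subU. Qed.
Lemma FqD u v : u \in U -> v \in U -> u + v \in U.
Proof. by move=> Uu; case/and3P: subU => _ /forall_inP/(_ _ Uu)/forall_inP h _; apply: h. Qed.
Lemma FqZ a u : a \in K -> u \in U -> a *: u \in U.
Proof. by move=> Ka; case/and3P: subU => _ _ /forall_inP/(_ _ Ka)/forall_inP; apply. Qed.
Lemma FqB u v : u \in U -> v \in U -> u - v \in U.
Proof.
move=> Uu Uv; rewrite -scaleN1r FqD // FqZ // -[-1]sub0r (subfieldB subK) //.
  exact: subfield0 subK.
exact: subfield1 subK.
Qed.

Lemma cardS_mul : (#|S| * (q ^ t - 1)).+1 = (q ^ (t * n))%N.
Proof.
rewrite cardS divnK; last first.
  rewrite mulnC expnM -[X in (_ %| _ - X)%N](exp1n n) subn_exp dvdn_mulr //.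
by rewrite (mulnC n) subn1 prednK // expn_gt0 (ltnW q_gt1).
Qed.

(** Kept general in [X] because it serves twice: for [U], and for a transversal, which has the same
    cardinality q^(tn). *)
Lemma S_cover (X : {set V}) :
  0 \in X -> #|X| = (q ^ (t * n))%N -> {in S, forall s : {set V}, (q ^ t <= #|s :&: X|)%N} ->
  {in X, forall v, v != 0 -> exists2 s, s \in S & v \in s}.
Proof.
move=> X0 cX sX; apply: (disjoint_cover (c := (q ^ t - 1)%N)) => //.
  move=> s Ss; have [sL _] := lineS Ss; rewrite (Lsubspace0 sL) /=.
  by rewrite subn1 prednK ?sX // expn_gt0 (ltnW q_gt1).
by rewrite cX cardS_mul.
Qed.

Lemma scattered_mem a u : u \in U -> u != 0 -> (a *: u \in U) = (a \in K).
Proof.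
move=> Uu u0; apply/idP/idP => [aU|aK]; last exact: FqZ.
apply: contraT => aK; have /implyP/(_ u0) := forall_inP scU u Uu.
rewrite expn1 => /eqP sc; have : (#|a |: K| <= q)%N.
  rewrite -sc -(card_imset _ (scaler_inj_r u0)); apply/subset_leq_card/subsetP => v.
  case/imsetP=> b /setU1P bK ->; rewrite inE; apply/andP; split; first exact: imset_f.
  by case: bK => [->|bK] //; apply: FqZ.
by rewrite cardsU1 aK cardK add1n ltnn.
Qed.

Definition transversal (T : {set V}) :=
  [/\ Lsubspace n n T, T :&: linset n U = set0
    & {in S, forall s : {set V}, exists v, [/\ v != 0, v \in s & v \in T]}].

Lemma transversal_disjoint T u : transversal T -> u \in T -> u \in U -> u = 0.
Proof.
case=> _ TU _ Tu Uu; apply/eqP; apply: contraT => u0.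
have : u \in T :&: linset n U by rewrite inE Tu mem_linset.
by rewrite TU inE.
Qed.

(** Modulo [T] the line [s] collapses to the span of [u]; this is how lines of [S] turn into points
    of the quotients. *)
Lemma transversal_line T s u : transversal T -> s \in S -> u \in s -> u \in U -> u != 0 ->
  exists2 v, v \in s :&: T & forall w, w \in s -> exists a b, w = a *: v + b *: u.
Proof.
move=> TT Ss su Uu u0; have [TL _ Ts] := TT.
have [v [v0 sv Tv]] := Ts s Ss; exists v; first by rewrite inE sv.
have [sL _] := lineS Ss.
have uv c : u <> c *: v.
  move=> E; case/eqP: u0; apply: (transversal_disjoint TT) => //.
  by rewrite E; apply: LsubspaceZ TL Tv.
by move=> w; rewrite (line_lincomb2 sL sv su v0 uv) => /lincomb2P.
Qed.

Lemma transversal_proj_inj T (P : 'M[L]_(2 * n, n)) :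
  transversal T -> (forall v, (v \in T) = (v *m P == 0)) -> {in U &, injective (mulmx^~ P)}.
Proof.
move=> TT PE u v Uu Uv /= E; apply/subr0_eq; apply: (transversal_disjoint TT).
  by rewrite PE mulmxBl E subrr.
exact: FqB.
Qed.

Lemma U_cover u : u \in U -> u != 0 -> exists2 s, s \in S & u \in s.
Proof.
by apply: S_cover; rewrite ?Fq0 // => s Ss; have [_ ->] := lineS Ss.
Qed.

Lemma graph_form T1 T2 : transversal T1 -> transversal T2 -> T1 != T2 ->
  exists i (M : 'M[L]_(2 * n)), [/\ (0 < i < t)%N, coprime i t, M \in unitmx
    & graph_set n phi i = [set u *m M | u in U]].
Proof.
move=> TT1 TT2 T12; have [[T1L _ T1s] [T2L _ T2s]] := (TT1, TT2).
have [P1 P1E] := Lsubspace_quotient T1L; have [P2 P2E] := Lsubspace_quotient T2L.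
have P1_inj := transversal_proj_inj TT1 P1E; have P2_inj := transversal_proj_inj TT2 P2E.
(* [U] meets [T1] only in 0 and has the cardinality of V/T1, so it projects bijectively; [lift]
   below is the inverse and F the map V/T1 -> V/T2 whose graph is [U]. *)
have onto1 x : exists2 u, u \in U & u *m P1 = x.
  have : x \in [set u *m P1 | u in U].
    suff -> : [set u *m P1 | u in U] = setT by rewrite inE.
    apply/eqP; rewrite eqEcard subsetT cardsT (card_in_imset P1_inj) cardU.
    by rewrite (card_rV n cardL) /= leqnn.
  by case/imsetP=> u Uu ->; exists u.
pose lift x := odflt 0 [pick u in U | u *m P1 == x].
have liftP x : lift x \in U /\ lift x *m P1 = x.
  rewrite /lift; case: pickP => [u /andP[Uu /eqP] //|none].
  by have [u Uu uE] := onto1 x; have := none u; rewrite Uu uE eqxx.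
have liftU x : lift x \in U by case: (liftP x).
have liftE x : lift x *m P1 = x by case: (liftP x).
have liftK u : u \in U -> lift (u *m P1) = u.
  by move=> Uu; apply: P1_inj => //=; rewrite liftE.
have lift0 x : (lift x == 0) = (x == 0).
  apply/eqP/eqP => [E|->]; first by rewrite -(liftE x) E mul0mx.
  by rewrite -(mul0mx _ P1) liftK ?Fq0.
pose F x := lift x *m P2.
have FP u : u \in U -> F (u *m P1) = u *m P2 by move=> Uu; rewrite /F liftK.
have F_inj : injective F.
  by move=> x y /P2_inj E; rewrite -(liftE x) E // liftE.
have FD : {morph F : x y / x + y}.
  move=> x y; rewrite /F -mulmxDl; congr (_ *m _); apply: P1_inj; rewrite ?FqD //=.
  by rewrite mulmxDl !liftE.
(* Let s be the line of [S] through [lift x]. Its q^t vectors in [U] project injectively from [T1]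
   into the span of x, hence onto it; so [lift (a *: x)] is in s, and s projects from [T2] into the
   span of [F x]. *)
have Fpt a x : exists b, F (a *: x) = b *: F x.
  case: (eqVneq x 0) => [->|x0].
    have /eqP l0 : lift 0 == 0 by rewrite lift0.
    by exists 0; rewrite scaler0 scale0r /F l0 mul0mx.
  have u0 : lift x != 0 by rewrite lift0.
  have [s Ss su] := U_cover (liftU x) u0; have [sL cs] := lineS Ss.
  have [v1] := transversal_line TT1 Ss su (liftU x) u0.
  rewrite inE P1E => /andP[_ /eqP v1P] s1.
  have [v2] := transversal_line TT2 Ss su (liftU x) u0.
  rewrite inE P2E => /andP[_ /eqP v2P] s2.
  have : a *: x \in [set u *m P1 | u in s :&: U].
    suff -> : [set u *m P1 | u in s :&: U] = [set b *: x | b : L] by apply: imset_f.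
    apply/eqP; rewrite eqEcard; apply/andP; split.
      apply/subsetP => _ /imsetP[w /setIP[sw _] ->]; have [b [c ->]] := s1 w sw.
      by rewrite mulmxDl -!scalemxAl v1P scaler0 add0r liftE; apply: imset_f.
    rewrite card_imset ?cardL; last exact: scaler_inj_r.
    rewrite card_in_imset ?cs // => w w' /setIP[_ Uw] /setIP[_ Uw'].
    exact: P1_inj.
  case/imsetP=> w /setIP[sw Uw] ->; rewrite FP //; have [b [c ->]] := s2 w sw.
  by exists c; rewrite mulmxDl -!scalemxAl v2P scaler0 add0r.
have [f [D uD FE]] := point_preserving_semilinear n_gt1 F_inj FD Fpt.
have [x0 x0_neq0] := rV_neq0_exists subK cardK cardL t_gt1 n_gt1.
have fK : {in K, forall k, f k = k}.
  move=> k Kk; have : F (k *: x0) = k *: F x0.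
    rewrite /F scalemxAl; congr (_ *m _); apply: P1_inj; rewrite ?FqZ //=.
    by rewrite liftE -scalemxAl liftE.
  rewrite !FE map_mxZ scalemxAl => /(can_inj (mulmxK uD)); apply: scaler_inj_r.
  by rewrite map_mx_eq0_rV.
have [i lt_it fE] := rmorph_frob subK cardK cardL t_gt1 phiE fK.
have {fE}FE x : F x = fv i x *m D.
  by rewrite FE; congr (_ *m _); apply/matrixP => k l; rewrite !mxE fE.
(* If i = 0 then F is L-linear. A nonzero w of [T1] is on a line of [S], where scatteredness and q^t
   > q give u, u' in [U] with u' = a w + b u and a nonzero. Linearity gives u' P2 = b u P2, so w is
   in [T2], and [T1] = [T2]. *)
have i0 : (0 < i)%N.
  case: posnP => // i0; case/eqP: T12; apply/eqP.
  rewrite eqEcard (card_Lsubspace T1L) (card_Lsubspace T2L) leqnn andbT.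
  apply/subsetP => w T1w; case: (eqVneq w 0) => [->|w0]; first exact: Lsubspace0 T2L.
  have [s Ss sw] : exists2 s, s \in S & w \in s.
    apply: (@S_cover T1) => //; first exact: Lsubspace0 T1L.
      by rewrite (card_Lsubspace T1L) cardL expnM.
    move=> s Ss; have [v [v0 sv Tv]] := T1s s Ss; have [sL _] := lineS Ss.
    rewrite -cardL -(card_imset _ (scaler_inj_r v0)); apply/subset_leq_card/subsetP.
    move=> _ /imsetP[a _ ->]; rewrite inE (LsubspaceZ a sL sv).
    exact: LsubspaceZ T1L Tv.
  have [sL cs] := lineS Ss.
  have [u /setIP[su Uu] u0] : exists2 u, u \in s :&: U & u != 0.
    have : (0 < #|(s :&: U) :\ (0%R : V)|)%N.
      have := cardsD1 (0 : V) (s :&: U); rewrite cs in_setI (Lsubspace0 sL) Fq0 add1n => E.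
      have : (q ^ 0 < q ^ t)%N by rewrite ltn_exp2l ?q_gt1 ?(ltnW t_gt1).
      by rewrite expn0 E ltnS.
    by case/card_gt0P=> u /setD1P[u0 ?]; exists u.
  have [u' /setIP[su' Uu'] u'L] : exists2 u', u' \in s :&: U & u' \notin Lspan n u.
    apply/subsetPn; apply/negP => /subsetP sub.
    have /implyP/(_ u0)/eqP := forall_inP scU u Uu; rewrite expn1 => sc.
    have : (#|s :&: U| <= #|Lspan n u :&: U|)%N.
      apply/subset_leq_card/subsetP => z zsU; rewrite inE sub //.
      by case/setIP: zsU.
    by rewrite cs sc leqNgt -{1}[q]expn1 ltn_exp2l ?q_gt1 ?t_gt1.
  have uw c : u <> c *: w.
    move=> E; case/eqP: u0; apply: (transversal_disjoint TT1) => //.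
    by rewrite E; apply: LsubspaceZ T1L T1w.
  move: (su'); rewrite (line_lincomb2 sL sw su w0 uw) => /lincomb2P[a [b u'E]].
  have a0 : a != 0.
    by apply: contraNneq u'L => a0; rewrite u'E a0 scale0r add0r; apply: imset_f.
  have wP1 : w *m P1 = 0 by apply/eqP; rewrite -P1E.
  have := FP _ Uu'; rewrite u'E !mulmxDl -!scalemxAl wP1 scaler0 add0r.
  have F_lin z : F (b *: z) = b *: F z by rewrite !FE i0 map_mxZ scalemxAl.
  rewrite F_lin FP // -[LHS]add0r => /addIr/esym/eqP.
  by rewrite scaler_eq0 (negPf a0) /= P2E.
pose M := P1 *m inj1 L n + P2 *m invmx D *m inj2 L n.
have ME v : v *m M = emb (v *m P1) (v *m P2 *m invmx D).
  by rewrite /M mulmxDr !mulmxA.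
have MU u : u \in U -> u *m M = graph phi i (u *m P1).
  by move=> Uu; rewrite ME -FP // FE mulmxK.
(* Replaces a proof that [T1] and [T2] are complementary. For a moved by [frob i], the images of
   [lift (a *: x)] and of a times [lift x] differ only in the second coordinate, by (a^(q^i) - a)
   x^(q^i). So the image of M contains the second axis, and with the graph it contains
   everything. *)
have uM : M \in unitmx.
  have [a fa] : exists a, frob i a != a.
    apply/existsP; apply: contraT; rewrite negb_exists => /forallP id_i.
    have : i = 0%N.
      apply: (frob_inj subK cardK cardL t_gt1 phiE lt_it (ltnW t_gt1)) => x.
      by apply/eqP; have := id_i x; rewrite negbK.
    by move=> iE; rewrite iE in i0.
  have img2 y : (emb 0 y <= M)%MS.
    set x := fv (t - i) ((frob i a - a)^-1 *: y).
    have -> : emb 0 y = lift (a *: x) *m M - a *: (lift x *m M).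
      rewrite !MU // !liftE /graph embZ embB subrr map_mxZ -scalerBl.
      by rewrite /x (fvVK cardL phiE (ltnW lt_it)) scalerA divff ?scale1r // subr_eq0.
    by rewrite addmx_sub ?submxMl // eqmx_opp scalemx_sub ?submxMl.
  rewrite -row_full_unit -sub1mx; apply/row_subP => k.
  rewrite -[row k _]emb_proj; set x := _ *m _; set y := _ *m _.
  have -> : emb x y = lift x *m M + emb 0 (y - fv i x).
    by rewrite MU // liftE /graph embD addr0 addrC subrK.
  by rewrite addmx_sub ?submxMl.
exists i, M; split=> //; first by rewrite i0.
  (* Otherwise some a outside [K] is fixed by [frob i], and [a *: lift x0] is again in [U], against
     scatteredness. *)
  apply: contraT => /(frob_fix_not_coprime subK cardK cardL t_gt1 phiE lt_it)[a aK fa].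
  have l0 : lift x0 != 0 by rewrite lift0.
  case/negP: aK; rewrite -(scattered_mem a (liftU x0) l0).
  suff -> : a *: lift x0 = lift (a *: x0) by [].
  apply: (can_inj (mulmxK uM)); rewrite -scalemxAl !MU // !liftE.
  by rewrite graphZ.
apply/setP => v; apply/imsetP/imsetP => [[x _ ->]|[u Uu ->]].
  by exists (lift x); rewrite // MU // liftE.
by exists (u *m P1); rewrite // MU.
Qed.
End Transversals.

Lemma pseudoregulus_graph_form A : pseudoregulus K q t n A ->
  exists i, [/\ (0 < i < t)%N, coprime i t & coll_equiv n A (graph_linset n phi i)].
Proof.
case/existsP=> U /and5P[subU /eqP -> /eqP cU scU /existsP[S /and4P[/eqP cS lS dS cT]]].
move: cT; set TS := [set T | _] => /cards2P[T1 [T2 [T12 TSE]]].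
have TT T : T \in TS -> transversal U S T.
  rewrite inE => /and3P[TL /eqP TU /forall_inP Ts]; split=> // s /Ts/existsP[v /and3P[? ? ?]].
  by exists v.
have lineS : {in S, forall s : {set V}, Lsubspace n 2 s /\ #|s :&: U| = (q ^ t)%N}.
  by move=> s Ss; have /andP[? /eqP] := forall_inP lS s Ss.
have disS : {in S &, forall s1 s2 : {set V}, s1 != s2 -> s1 :&: s2 = [set 0]}.
  move=> s1 s2 S1 S2 s12; apply/eqP; move: s12; apply/implyP.
  exact: (forall_inP (forall_inP dS s1 S1) s2 S2).
have [||i [M [it cit uM GE]]] :=
  graph_form subU cU scU cS lineS disS (T1 := T1) (T2 := T2) _ _ T12.
- by apply: TT; rewrite TSE set21.
- by apply: TT; rewrite TSE set22.
exists i; split=> //; rewrite /graph_linset GE linset_imset //.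
exact: coll_equiv_imset.
Qed.

Lemma coll_equiv_graph_linset i j : (2 < t)%N ->
  (0 < i < t)%N -> coprime i t -> (0 < j < t)%N -> coprime j t ->
  coll_equiv n (graph_linset n phi i) (graph_linset n phi j) = (j == i) || (j == t - i)%N.
Proof.
move=> t_gt2 it cit jt cjt; apply/idP/idP => [/coll_equivP[f [M [uM]]]|]; last first.
  case/orP=> /eqP ->; first exact: coll_equiv_refl.
  rewrite (graph_linset_swap n cardL phiE); last by lia.
  exact: coll_equiv_imset (swap_mx_unit L n).
have -> : [set map_mx f v *m M | v in graph_linset n phi i]
    = [set v *m M | v in [set map_mx f v | v in graph_linset n phi i]].
  by rewrite -imset_comp.
(* Field automorphisms commute with x -> x^(q^i), so they stabilise each canonical set and only the
   linear part of a collineation matters. *)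
have -> : [set map_mx f v | v in graph_linset n phi i] = graph_linset n phi i.
  apply/eqP; rewrite eqEcard; apply/andP; split.
    apply/subsetP => _ /imsetP[_ /graph_linsetP[a [x [a0 x0 ->]]] ->].
    apply/graph_linsetP; exists (f a), (map_mx f x).
    rewrite fmorph_eq0 map_mx_eq0_rV; split=> //; rewrite map_mxZ map_emb.
    congr (_ *: emb _ _); apply/matrixP => k l.
    by rewrite !mxE !(frobE phiE) rmorphXn.
  rewrite card_imset //; exact: map_mx_inj.
by case/(graph_linset_imset_inv subK cardK cardL t_gt1 phiE n_gt1 t_gt2 it cit jt cjt uM)
  => ->; rewrite eqxx ?orbT.
Qed.
End CanonicalForm.

Theorem theorem3p13 (L : finFieldType) (K : {set L}) (q t n : nat) :
  is_subfield K -> #|K| = q -> #|L| = (q ^ t)%N ->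
  (2 <= n)%N -> (3 <= t)%N ->
  #|pr_orbits K q t n| = (totient t %/ 2)%N.
Proof.
move=> subK cardK cardL n_gt1 t_gt2; have t_gt1 := ltnW t_gt2.
have [phi phiE] := frobenius_exists subK cardK cardL t_gt1.
pose I := [set i : 'I_t | coprime i t].
have I0 (i : 'I_t) : i \in I -> (0 < i < t)%N.
  rewrite inE ltn_ord andbT; case: posnP => // ->.
  by rewrite /coprime gcd0n => /eqP E; rewrite E in t_gt1.
have cI (i : 'I_t) : i \in I -> coprime i t by rewrite inE.
pose orb A := [set B in [set A | pseudoregulus K q t n A] | coll_equiv n A B].
have orbP A B : (B \in orb A) = pseudoregulus K q t n B && coll_equiv n A B.
  by rewrite in_set in_set.
have orbsE : pr_orbits K q t n = [set orb A | A in [set A | pseudoregulus K q t n A]] by [].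
clearbody orb.
pose G (i : 'I_t) := graph_linset n phi i.
have PRG i : i \in I -> pseudoregulus K q t n (G i).
  move=> Ii.
  by apply: (graph_linset_pseudoregulus subK cardK cardL t_gt1 phiE n_gt1 (I0 _ Ii) (cI _ Ii)).
have orbE A B : coll_equiv n A B -> orb A = orb B.
  move=> AB; apply/setP => C; rewrite !orbP; congr andb; apply/idP/idP.
    exact: (coll_equiv_trans (coll_equiv_sym AB)).
  exact: (coll_equiv_trans AB).
have -> : pr_orbits K q t n = [set orb (G i) | i in I].
  rewrite orbsE; apply/setP => O; apply/imsetP/imsetP => [[A + ->]|[i Ii ->]]; last first.
    by exists (G i); rewrite // inE PRG.
  rewrite inE => /(pseudoregulus_graph_form subK cardK cardL t_gt1 phiE n_gt1).
  case=> i [/andP[i0 it] cit AG]; exists (Ordinal it); first by rewrite inE.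
  exact: orbE.
have orb_eq i j : i \in I -> j \in I ->
    (orb (G j) == orb (G i)) = (j == i) || (j == t - i :> nat)%N.
  move=> Ii Ij.
  rewrite -(coll_equiv_graph_linset subK cardK cardL t_gt1 phiE n_gt1 t_gt2
    (I0 _ Ii) (cI _ Ii) (I0 _ Ij) (cI _ Ij)).
  apply/eqP/idP => [E|/orbE-> //].
  have : G j \in orb (G i) by rewrite -E orbP PRG // coll_equiv_refl.
  by rewrite orbP => /andP[].
have cardI : #|I| = totient t.
  rewrite totient_count_coprime big_mkord -sum1_card big_mkcond /=.
  by apply: eq_bigr => i _; rewrite inE coprime_sym; case: coprime.
(* Each orbit arises from exactly the two exponents i and t - i. *)
rewrite -cardI (card_imset_fibers (f := fun i => orb (G i)) (k := 2)); first by rewrite mulnK.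
move=> i Ii; have /andP[i0 it] := I0 i Ii.
have ti : (t - i < t)%N by lia.
have Iti : Ordinal ti \in I.
  have E : gcdn i (i + (t - i)) = gcdn (t - i) (i + (t - i)).
    by rewrite gcdnDl gcdnDr gcdnC.
  by rewrite (subnKC (ltnW it)) in E; rewrite inE /coprime /= -E; apply: cI.
have -> : [set j in I | orb (G j) == orb (G i)] = [set i; Ordinal ti].
  apply/setP => j; rewrite in_set2 in_set.
  have -> : (j == Ordinal ti) = (j == t - i :> nat)%N by [].
  case: (boolP (j \in I)) => [Ij|nIj]; first by rewrite /= orb_eq.
  apply/esym/negbTE; apply: contra nIj => /orP[/eqP-> //|/eqP E].
  by have -> : j = Ordinal ti by apply: val_inj.
(* If i = t - i then i divides t = 2 i; coprimality gives i = 1 and t = 2, excluded by t >= 3. *)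
have ne : (i != Ordinal ti).
  apply/eqP => /(congr1 val) /= E.
  have /gcdn_idPl g : (i %| t)%N by apply/dvdnP; exists 2%N; lia.
  by have := cI i Ii; rewrite /coprime g => /eqP; lia.
by rewrite cards2 ne.
Qed.
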